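(* Let $X$ be an algebraic variety of positive dimension over an algebraically closed field $k$ and let $x\in X$ be a closed point. The canonical map $\pi:\mathrm{RZ}(X,x)\to\mathrm{NL}(X,x)$ (defined in the context) is surjective and continuous.
   Context: An algebraic variety over $k$ is an integral separated scheme of finite type over $k$. Let $K$ be the function field of $X$, $\mathcal{O}_{X,x}$ the local ring at $x$ and $\mathfrak{m}_{X,x}$ its maximal ideal. For a valuation $\nu$ of $K$, $R_\nu$ is its valuation ring and $m_\nu$ the maximal ideal of $R_\nu$. Riemann--Zariski space: $\mathrm{RZ}(X,x)$ is the set of all valuations $\nu$ of $K$ (of arbitrary rank, up to equivalence) that are trivial on $k$ and whose valuation ring dominates $\mathcal{O}_{X,x}$, i.e. $\mathcal{O}_{X,x}\subseteq R_\nu$ and $m_\nu\cap\mathcal{O}_{X,x}=\mathfrak{m}_{X,x}$ (one says $\nu$ is centered in $x$). It carries the topology with basis the sets $\{\nu : A\subset R_\nu\}$, $A$ a finite subset of $K$. Normalized non-Archimedean link: $\mathrm{NL}(X,x)$ is (identified with) the set of all maps $v:\mathcal{O}_{X,x}\to[0,+\infty]$ such that $v(0)=+\infty$, $v|_{k^*}=0$, $v(fg)=v(f)+v(g)$ and $v(f+g)\ge\min\{v(f),v(g)\}$ for all $f,g$, and $v(\mathfrak{m}_{X,x}):=\min\{v(f): f\in\mathfrak{m}_{X,x}\}=1$. It carries the topology of pointwise convergence. Definition of $\pi$: let $\nu\in\mathrm{RZ}(X,x)$ have rank $r\ge1$, and consider the maximal chain of valuation rings $R_\nu=R_{\nu_r}\subsetneq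 R_{\nu_{r-1}}\subsetneq\dots\subsetneq R_{\nu_1}$ of $K$ (all different from $K$; $\nu_i$ has rank $i$). Let $j$ be the smallest $i\in\{1,\dots,r\}$ such that $\nu_i$ is centered in $x$. If $j=1$, regard the rank one valuation $\nu_1$ as real valued and set $\pi(\nu)(f)=\nu_1(f)/\nu_1(\mathfrak{m}_{X,x})$ for every nonzero $f\in\mathcal{O}_{X,x}$, where $\nu_1(\mathfrak{m}_{X,x})=\min\{\nu_1(g):g\in\mathfrak{m}_{X,x}\}$. If $j>1$, let $\overline{\nu}_{j-1}$ be the (real valued) rank one valuation of the residue field of $R_{\nu_{j-1}}$ with valuation ring $R_{\nu_j}/m_{\nu_{j-1}}$; then $\pi(\nu)$ is the unique multiple by a positive real constant lying in $\mathrm{NL}(X,x)$ of the semivaluation sending $f\in\mathcal{O}_{X,x}$ to $\overline{\nu}_{j-1}(\bar f)$ if $f\notin m_{\nu_{j-1}}$, where $\bar f$ is the class of $f$ in $\mathcal{O}_{X,x}/(\mathcal{O}_{X,x}\cap m_{\nu_{j-1}})$, and to $+\infty$ if $f\in m_{\nu_{j-1}}$. *)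

(* Defs.v *)
From HB Require Import structures.
From mathcomp Require Import all_boot all_order all_algebra.
From mathcomp Require Import all_classical all_reals all_analysis.

Set Implicit Arguments.
Unset Strict Implicit.
Unset Printing Implicit Defensive.

Import Order.TTheory GRing.Theory Num.Theory.

Local Open Scope classical_set_scope.
Local Open Scope ring_scope.

(* A topological space with a sheaf of commutative rings. Sections and
   restrictions are indexed by arbitrary subsets, but only their values at open
   subsets carry information (a presheaf on the open subsets extends to all
   subsets through the interior). *)
Record ringed_space := RingedSpace {
  space :> topologicalType;
  sec : set space -> comPzRingType;
  res : forall U V : set space, V `<=` U -> {rmorphism sec U -> sec V};
  res_id : forall (U : set space) (UU : U `<=` U) (s : sec U),
    open U -> res UU s = s;
  res_comp : forall (U V W : set space)
      (VU : V `<=` U) (WV : W `<=` V) (WU : W `<=` U) (s : sec U),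
    open U -> open V -> open W -> res WV (res VU s) = res WU s;
  sheaf_locality : forall (U : set space) (I : Type) (V : I -> set space)
      (VU : forall i, V i `<=` U) (s t : sec U),
    open U -> (forall i, open (V i)) -> U `<=` \bigcup_i V i ->
    (forall i, res (VU i) s = res (VU i) t) -> s = t;
  sheaf_gluing : forall (U : set space) (I : Type) (V : I -> set space)
      (VU : forall i, V i `<=` U) (s : forall i, sec (V i)),
    open U -> (forall i, open (V i)) -> U `<=` \bigcup_i V i ->
    (forall i j, res (@subIsetl _ (V i) (V j)) (s i) =
                 res (@subIsetr _ (V i) (V j)) (s j)) ->
    exists t : sec U, forall i, res (VU i) t = s i
}.

(* The set of points x of U at which the germ of s is invertible in the stalk
   at x, i.e. the basic open subset D(s) when U is affine. *)
Definition basic_open (X : ringed_space) (U : set X) (s : sec U) : set X :=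
  [set x | exists (V : set X) (VU : V `<=` U),
     [/\ open V, V x & exists t : sec V, res VU s * t = 1]].

Lemma basic_open_sub (X : ringed_space) (U : set X) (s : sec U) :
  basic_open s `<=` U.
Proof. by move=> x [V [VU [_ Vx _]]]; exact: VU. Qed.

Definition vanishing_ideal (X : ringed_space) (U : set X) (x : X)
  : set (sec U) := [set s | ~ basic_open s x].

Definition prime_ideal (A : comPzRingType) (p : set A) : Prop :=
  [/\ p 0, (forall a b, p a -> p b -> p (a + b)),
      (forall a b, p b -> p (a * b)), ~ p 1
    & (forall a b, p (a * b) -> p a \/ p b)].

(* f exhibits B as the localization of A at the powers of s. *)
Definition is_localization (A B : comPzRingType) (f : A -> B) (s : A) : Prop :=
  [/\ exists u, f s * u = 1,
      forall b, exists n a, f a = b * f s ^+ n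
    & forall a, f a = 0 -> exists n, s ^+ n * a = 0].

(* (U, O_U) is isomorphic to Spec (O(U)): the canonical map from U to
   Spec (O(U)), sending x to the ideal of the sections vanishing at x, is well
   defined and bijective (first two clauses) and a homeomorphism (third clause),
   and O(D(s)) is the localization O(U)_s for every section s over U. *)
Definition affine_open (X : ringed_space) (U : set X) : Prop :=
  open U /\
  [/\ forall x, U x -> prime_ideal (@vanishing_ideal X U x),
      forall p : set (sec U), prime_ideal p ->
        exists! x, U x /\ vanishing_ideal x = p,
      forall (V : set X) x, open V -> V x -> U x ->
        exists s : sec U, basic_open s x /\ basic_open s `<=` V
    & forall s : sec U, is_localization (res (@basic_open_sub X U s)) s].

Definition is_scheme (X : ringed_space) : Prop :=
  forall x : X, exists2 U, affine_open U & U x.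

Definition integral_domain (A : comPzRingType) : Prop :=
  (1 : A) <> 0 /\ forall a b : A, a * b = 0 -> a = 0 \/ b = 0.

Definition is_integral (X : ringed_space) : Prop :=
  [set: X] !=set0 /\
  forall U : set X, open U -> U !=set0 -> integral_domain (sec U).

(* A ringed space over Spec k. *)
Record space_over (k : fieldType) := SpaceOver {
  underlying :> ringed_space;
  structure_map : {rmorphism k -> sec [set: underlying]}
}.

Definition scalar_section (k : fieldType) (X : space_over k) (U : set X) (c : k)
  : sec U := res (@subsetT _ U) (structure_map X c).

Definition finitely_generated (k : fieldType) (X : space_over k) (U : set X)
  : Prop :=
  exists g : seq (sec U), forall B : set (sec U),
    (forall c, B (scalar_section U c)) -> (forall s, s \in g -> B s) ->
    (forall s t, B s -> B t -> B (s + t)) ->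
    (forall s t, B s -> B t -> B (s * t)) -> B = setT.

Definition finite_type (k : fieldType) (X : space_over k) : Prop :=
  exists (n : nat) (U : 'I_n -> set X),
    (forall i, affine_open (U i) /\ finitely_generated (U i)) /\
    \bigcup_i U i = setT.

(* The diagonal of a scheme X over k is a closed immersion iff, for all affine
   open subsets U and V, its restriction over U x V is, i.e. iff the intersection
   of U and V is affine and the map from the tensor product of O(U) and O(V)
   over k to its ring of sections is surjective; the image of that map is the
   subring generated by the restrictions. *)
Definition is_separated (X : ringed_space) : Prop :=
  forall U V : set X, affine_open U -> affine_open V ->
    affine_open (U `&` V) /\
    forall B : set (sec (U `&` V)),
      (forall s : sec U, B (res (@subIsetl _ U V) s)) ->
      (forall t : sec V, B (res (@subIsetr _ U V) t)) ->
      (forall s t, B s -> B t -> B (s + t)) ->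
      (forall s t, B s -> B t -> B (s * t)) -> B = setT.

Record variety (k : fieldType) := Variety {
  variety_space :> space_over k;
  variety_scheme : is_scheme variety_space;
  variety_integral : is_integral variety_space;
  variety_separated : is_separated variety_space;
  variety_finite_type : finite_type variety_space
}.

Definition irreducible_closed (T : topologicalType) (Z : set T) : Prop :=
  [/\ closed Z, Z !=set0
    & forall A B : set T, closed A -> closed B -> Z `<=` A `|` B ->
        Z `<=` A \/ Z `<=` B].

(* The Krull dimension of T is at least n. *)
Definition dim_ge (T : topologicalType) (n : nat) : Prop :=
  exists Z : nat -> set T,
    (forall i, (i <= n)%N -> irreducible_closed (Z i)) /\
    (forall i, (i < n)%N -> Z i `<` Z i.+1).

(* A, with its germ maps, is the stalk at x, i.e. the filtered colimit of the
   rings of sections over the open neighbourhoods of x. *)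
Record stalk (X : ringed_space) (x : X) (A : comPzRingType) := Stalk {
  germ : forall U : set X, open_nbhs x U -> {rmorphism sec U -> A};
  germ_res : forall (U V : set X) (xU : open_nbhs x U) (xV : open_nbhs x V)
    (VU : V `<=` U) (s : sec U), germ xV (res VU s) = germ xU s;
  germ_surj : forall a : A,
    exists (U : set X) (xU : open_nbhs x U) (s : sec U), germ xU s = a;
  germ_inj : forall (U : set X) (xU : open_nbhs x U) (s : sec U),
    germ xU s = 0 ->
    exists (V : set X) (VU : V `<=` U), open_nbhs x V /\ res VU s = 0
}.

(* K is the function field of X, i.e. the stalk at the generic point. *)
Record function_field (X : ringed_space) (K : fieldType) := FunctionField {
  generic_point : X;
  generic_pointP : closure [set generic_point] = setT;
  generic_stalk : stalk generic_point K
}.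

Lemma open_nbhs_setT (T : topologicalType) (x : T) : open_nbhs x setT.
Proof. by split=> //; exact: openT. Qed.

Definition constant_function (k : fieldType) (X : space_over k) (K : fieldType)
    (F : function_field X K) (c : k) : K :=
  germ (generic_stalk F) (open_nbhs_setT (generic_point F)) (structure_map X c).

Section LocalRing.
Variables (X : ringed_space) (K : fieldType) (F : function_field X K) (x : X).

(* The local ring of X at x as a subring of K: the functions regular at x. *)
Definition local_ring_pred : {pred K} := [pred f : K | `[<
  exists (U : set X) (xU : open_nbhs x U)
    (etaU : open_nbhs (generic_point F) U) (s : sec U),
    germ (generic_stalk F) etaU s = f >]].

Lemma local_ring_closed : subring_closed local_ring_pred.
Proof.
split.
- apply/asboolP; exists setT, (open_nbhs_setT _), (open_nbhs_setT _), 1.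
  by rewrite rmorph1.
- move=> _ _ /asboolP[U [xU [eU [s <-]]]] /asboolP[V [xV [eV [t <-]]]].
  apply/asboolP; have xW := open_nbhsI xU xV; have eW := open_nbhsI eU eV.
  exists (U `&` V), xW, eW.
  exists (res (@subIsetl _ U V) s - res (@subIsetr _ U V) t).
  by rewrite rmorphB (germ_res _ eU) (germ_res _ eV).
- move=> _ _ /asboolP[U [xU [eU [s <-]]]] /asboolP[V [xV [eV [t <-]]]].
  apply/asboolP; have xW := open_nbhsI xU xV; have eW := open_nbhsI eU eV.
  exists (U `&` V), xW, eW.
  exists (res (@subIsetl _ U V) s * res (@subIsetr _ U V) t).
  by rewrite rmorphM (germ_res _ eU) (germ_res _ eV).
Qed.

HB.instance Definition _ :=
  GRing.isSubringClosed.Build K local_ring_pred local_ring_closed.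

Record local_ring := LocalRing {
  regular_fun :> K;
  _ : regular_fun \in local_ring_pred
}.
HB.instance Definition _ := [isSub for regular_fun].
HB.instance Definition _ := [Choice of local_ring by <:].
HB.instance Definition _ := [SubChoice_isSubComNzRing of local_ring by <:].

Definition local_ring_set : set K := [set` local_ring_pred].

End LocalRing.

(* For a local subring S of K this is its maximal ideal. *)
Definition nonunits (K : fieldType) (S : set K) : set K :=
  [set f | S f /\ ~ exists2 g, S g & f * g = 1].

(* Valuations of K up to equivalence are identified with their rings. *)
Definition valuation_ring (K : fieldType) (S : set K) : Prop :=
  [/\ S 1, (forall f g, S f -> S g -> S (f - g)),
      (forall f g, S f -> S g -> S (f * g))
    & forall f, f != 0 -> S f \/ S f^-1].

Section RiemannZariski.
Variables (k : fieldType) (X : space_over k) (K : fieldType).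
Variables (F : function_field X K) (x : X).

Definition centered (S : set K) : Prop :=
  local_ring_set F x `<=` S /\
  nonunits S `&` local_ring_set F x = nonunits (local_ring_set F x).

Record RZ := MkRZ {
  ring_of :> set K;
  ring_ofP : valuation_ring ring_of;
  ring_of_constant : forall c : k, ring_of (constant_function F c);
  ring_of_centered : centered ring_of
}.

HB.instance Definition _ := gen_eqMixin RZ.
HB.instance Definition _ := gen_choiceMixin RZ.

Definition RZ_basis (A : set K) : set RZ := [set nu | A `<=` ring_of nu].

Lemma RZ_basis_cover : \bigcup_(A in @finite_set K) RZ_basis A = setT.
Proof. by apply/seteqP; split=> // nu _; exists set0. Qed.

Lemma RZ_basis_join (A B : set K) (nu : RZ) :
  finite_set A -> finite_set B -> RZ_basis A nu -> RZ_basis B nu ->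
  exists C, [/\ finite_set C, RZ_basis C nu
              & RZ_basis C `<=` RZ_basis A `&` RZ_basis B].
Proof.
move=> fA fB nuA nuB; exists (A `|` B); split.
- by rewrite finite_setU.
- by move=> f [/nuA|/nuB].
- by move=> mu muC; split=> f ?; apply: muC; [left|right].
Qed.

HB.instance Definition _ :=
  isBaseTopological.Build RZ RZ_basis_cover RZ_basis_join.

End RiemannZariski.

Section Link.
Local Open Scope ereal_scope.
Variable R : realType.

Definition is_minimum (A : set (\bar R)) (c : \bar R) : Prop :=
  A c /\ forall a, A a -> c <= a.

Variables (k : fieldType) (X : space_over k) (K : fieldType).
Variables (F : function_field X K) (x : X).

Definition is_normalized_semivaluation (v : local_ring F x -> \bar R) : Prop :=
  (forall f, 0 <= v f) /\
  [/\ v 0%R = +oo,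
      forall (c : k) (f : local_ring F x),
        c != 0%R -> regular_fun f = constant_function F c -> v f = 0,
      forall f g, v (f * g)%R = v f + v g,
      forall f g, mine (v f) (v g) <= v (f + g)%R
    & is_minimum
        [set v f | f in [set f : local_ring F x |
           nonunits (local_ring_set F x) (regular_fun f)]] 1].

(* [set_type] gives NL the subspace topology of pointwise convergence. *)
Definition NL : Type :=
  set_type ([set v | is_normalized_semivaluation v]
    : set {ptws local_ring F x -> \bar R}).

Definition value (v : NL) : local_ring F x -> \bar R := set_val v.

End Link.

Section CanonicalMap.
Local Open Scope ereal_scope.

(* A valuation w of the field L with values in the reals whose valuation ring
   is S; it has rank one as soon as S is not L. *)
Definition real_valuation (R : realType) (L : fieldType) (w : L -> \bar R)
    (S : set L) : Prop :=
  [/\ w 0%R = +oo, (forall f, f != 0%R -> w f \is a fin_num),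
      (forall f g, w (f * g)%R = w f + w g),
      (forall f g, mine (w f) (w g) <= w (f + g)%R)
    & [set f | 0 <= w f] = S].

(* red, meaningful on T only, exhibits L as the residue field of T. *)
Definition is_residue_field (K : fieldType) (T : set K) (L : fieldType)
    (red : K -> L) : Prop :=
  [/\ red 1%R = 1%R,
      (forall f g, T f -> T g -> red (f + g)%R = (red f + red g)%R),
      (forall f g, T f -> T g -> red (f * g)%R = (red f * red g)%R),
      red @` T = setT
    & forall f, T f -> (red f = 0%R <-> nonunits T f)].

(* C 1, ..., C r are the valuation rings between S and K, other than K,
   in decreasing order. *)
Definition is_maximal_chain (K : fieldType) (S : set K) (r : nat)
    (C : nat -> set K) : Prop :=
  [/\ (1 <= r)%N, C r = S,
      forall i, (1 <= i <= r)%N -> valuation_ring (C i) /\ C i <> setT,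
      forall i, (1 <= i < r)%N -> C i.+1 `<` C i
    & forall T, valuation_ring T -> S `<=` T -> T <> setT ->
        exists2 i, (1 <= i <= r)%N & C i = T].

Variables (R : realType) (k : fieldType) (X : space_over k) (K : fieldType).
Variables (F : function_field X K) (x : X).

Definition image_rank_one (S : set K) (v : local_ring F x -> \bar R) : Prop :=
  exists (w : K -> \bar R) (c : R),
    [/\ real_valuation w S, is_minimum (w @` nonunits (local_ring_set F x)) c%:E
      & forall f : local_ring F x, f != 0%R ->
          v f = w (regular_fun f) * (c^-1)%:E].

Definition image_composite (T S : set K) (v : local_ring F x -> \bar R)
    : Prop :=
  exists (L : fieldType) (red : K -> L) (w : L -> \bar R) (c : R),
    [/\ is_residue_field T red, real_valuation w (red @` S), (0 < c)%R
      & forall f : local_ring F x,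
          (nonunits T (regular_fun f) -> v f = +oo) /\
          (~ nonunits T (regular_fun f) ->
             v f = c%:E * w (red (regular_fun f)))].

(* v is the image of nu under the canonical map. *)
Definition is_canonical_image (nu : RZ F x) (v : NL R F x) : Prop :=
  exists (r : nat) (C : nat -> set K) (j : nat),
    [/\ is_maximal_chain nu r C, (1 <= j <= r)%N, centered F x (C j),
        forall i, (1 <= i < j)%N -> ~ centered F x (C i)
      & (j = 1%N -> image_rank_one (C 1%N) (value v)) /\
        ((1 < j)%N -> image_composite (C j.-1) (C j) (value v))].

End CanonicalMap.

(* Main.v *)
(* Let [c] be an element of the maximal ideal [m] of least value for [nu], which
   exists because [m] is finitely generated (Hilbert's basis theorem). A valuation
   ring containing [R_nu] is centered in [x] iff [c] is not a unit in it, so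
   [R_(nu_j)] is the largest overring where [c] is not a unit, [R_(nu_(j-1))] the
   smallest one (possibly [K]) where it is, and, whatever [j],
     pi(nu)(f) = sup {a / b | f^b / c^a in R_nu}.
   The conditions pi(nu)(f) > q and pi(nu)(f) < q are therefore open where a fixed
   [c] can be used, whence the continuity. Given [v] in [NL(X, x)], the fractions
   [f / g] with v(f) >= v(g) and v(g) finite form a local ring; by Chevalley's
   extension theorem a valuation ring dominates it, and the formula shows that [v]
   is its image. The rank is finite because elements separating the members of a
   chain of overrings are algebraically independent over [k]. *)

From HB Require Import structures.
Require Import Defs.
From mathcomp Require Import all_boot all_order all_algebra.
From mathcomp Require Import all_classical all_reals all_analysis.
From mathcomp Require Import ring_quotient generic_quotient ring lra.

Set Implicit Arguments.
Unset Strict Implicit.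
Unset Printing Implicit Defensive.

Local Open Scope classical_set_scope.

Import Order.TTheory GRing.Theory Num.Theory.
Local Open Scope ring_scope.

(** * Valuation rings and their overrings *)

(** The supremum formula takes the place of value groups and of an embedding of rank one groups in
    the reals: it is a Dedekind cut read off from the ring alone, and it treats j = 1 and j > 1
    alike. Its subtlety is at the boundary. Membership of f^b / c^a only gives pi(nu)(f) >= a / b,
    and only pi(nu)(f) > a / b gives the membership back; at equality both answers occur in higher
    rank. Comparisons therefore use strict inequalities on one side and close the gap by density of
    the fractions. Basic open sets of [RZ] impose memberships only, so an upper bound on pi(nu)(f)
    looks like a closed condition. It is open because in a valuation ring the absence of h forces
    the presence of h^-1. A fixed c serves near nu because its minimality need only be tested on
    finitely many generators of m. The definition of an image leaves the residue field, the real
    valuation and the constant free; all choices are shown to yield the formula, for every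
    admissible c, so the map is well defined. *)

Section Subrings.
Context {K : fieldType}.
Implicit Types (S T : set K) (f g : K).

Definition is_subring S :=
  [/\ S 1, forall f g, S f -> S g -> S (f - g)
    & forall f g, S f -> S g -> S (f * g)].

Section Closure.
Context {S : set K} (subS : is_subring S).

Lemma subring1 : S 1. Proof. by case: subS. Qed.
Lemma subringB f g : S f -> S g -> S (f - g). Proof. by case: subS => _ + _; apply. Qed.
Lemma subringM f g : S f -> S g -> S (f * g). Proof. by case: subS => _ _; apply. Qed.
Lemma subring0 : S 0. Proof. by rewrite -(subrr 1); apply: subringB; exact: subring1. Qed.
Lemma subringN f : S f -> S (- f).
Proof. by move=> Sf; rewrite -sub0r; apply: subringB => //; exact: subring0. Qed.
Lemma subringD f g : S f -> S g -> S (f + g).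
Proof. by move=> Sf Sg; rewrite -(opprK g); apply: subringB => //; exact: subringN. Qed.
Lemma subringX f n : S f -> S (f ^+ n).
Proof.
move=> Sf; elim: n => [|n IH]; first exact: subring1.
by rewrite exprS; apply: subringM.
Qed.
Lemma subring_sum (I : Type) (r : seq I) (P : pred I) (F : I -> K) :
  (forall i, P i -> S (F i)) -> S (\sum_(i <- r | P i) F i).
Proof. by move=> SF; elim/big_ind: _ => //; [exact: subring0|exact: subringD]. Qed.
End Closure.

Lemma nonunitsE S f : nonunits S f <-> S f /\ (f = 0 \/ ~ S f^-1).
Proof.
split=> -[Sf fN]; split=> //.
  have [->|f0] := eqVneq f 0; [by left|right=> Sf'].
  by apply: fN; exists f^-1 => //; rewrite divff.
move=> [g Sg fg1].
have f0 : f != 0 by apply: contra_eq_neq fg1 => ->; rewrite mul0r eq_sym oner_eq0.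
case: fN => [/eqP|]; first by rewrite (negbTE f0).
by apply; rewrite -(mulKf f0 g) fg1 mulr1 in Sg.
Qed.

Lemma nonunits0 S : S 0 -> nonunits S 0.
Proof. by move=> S0; apply/nonunitsE; split=> //; left. Qed.

Lemma not_nonunits S f : S f -> ~ nonunits S f -> f != 0 /\ S f^-1.
Proof.
move=> Sf /nonunitsE fN; split; last first.
  by apply: contrapT => h; apply: fN; split=> //; right.
by apply/eqP => f0; apply: fN; split=> //; left.
Qed.

Section Valuation.
Context {V : set K} (hV : valuation_ring V).

Lemma valuation_subring : is_subring V. Proof. by case: hV. Qed.
Let sV := valuation_subring.

Lemma valuation_total f : V f \/ V f^-1.
Proof.
have [->|f0] := eqVneq f 0; first by left; exact: subring0.
by case: hV => _ _ _; apply.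
Qed.

Lemma valuation_nonunitsE f : nonunits V f <-> f = 0 \/ ~ V f^-1.
Proof.
rewrite nonunitsE; split=> [[]//|h]; split=> //.
by case: h => [->|h]; [exact: subring0|case: (valuation_total f)].
Qed.

Lemma nonunits_sub f : nonunits V f -> V f. Proof. by case. Qed.

Lemma valuation_nonunitsM f g : V f -> nonunits V g -> nonunits V (f * g).
Proof.
move=> Vf /valuation_nonunitsE gN; apply/valuation_nonunitsE.
have [->|f0] := eqVneq f 0; first by left; rewrite mul0r.
case: gN => [->|gN]; [by left; rewrite mulr0|right].
rewrite invfM => h; apply: gN.
by rewrite -(mulVKf f0 g^-1); exact: (subringM sV).
Qed.

Lemma valuation_nonunitsD f g :
  nonunits V f -> nonunits V g -> nonunits V (f + g).
Proof.
move=> fN gN.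
have [->|f0] := eqVneq f 0; first by rewrite add0r.
have [->|g0] := eqVneq g 0; first by rewrite addr0.
case: (valuation_total (f / g)) => h.
  have -> : f + g = (f / g + 1) * g by rewrite mulrDl divfK// mul1r.
  by apply: valuation_nonunitsM => //; apply: (subringD sV) => //; exact: subring1.
have -> : f + g = (1 + g / f) * f by rewrite mulrDl divfK// mul1r.
apply: valuation_nonunitsM => //; apply: (subringD sV).
  exact: subring1.
by rewrite -invf_div.
Qed.

(** A case of integral closedness: were [f^-1] in [V], the identity f = f^(n+1) (f^-1)^n would put
    [f] in [V] as well. *)
Lemma valuation_root f n : V (f ^+ n.+1) -> V f.
Proof.
move=> h; case: (valuation_total f) => // h'.
have [->|f0] := eqVneq f 0; first exact: subring0.
have -> : f = f ^+ n.+1 * f^-1 ^+ n.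
  by rewrite exprVn exprS mulfK// expf_neq0.
by apply: (subringM sV) => //; exact: subringX.
Qed.

Lemma overring_valuation T : is_subring T -> V `<=` T -> valuation_ring T.
Proof.
case=> T1 TB TM VT; split=> // f f0.
by case: (valuation_total f) => /VT; [left|right].
Qed.

(** A larger ring inverts more elements, so the inclusion is reversed. This is how membership in [V]
    itself is deduced from information about an overring. *)
Lemma overring_nonunits T : valuation_ring T -> V `<=` T ->
  nonunits T `<=` nonunits V.
Proof.
case=> T1 TB TM _ VT f /nonunitsE[_ fN]; apply/valuation_nonunitsE.
by case: fN => [->|fN]; [left|right=> /VT].
Qed.

(** Given [f] in [S] only and [g] in [T] only, one of f/g and g/f lies in [V], and multiplying by it
    carries one of the two elements into the ring that omits it. *)
Lemma overring_total S T : is_subring S -> is_subring T -> V `<=` S -> V `<=` T ->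
  S `<=` T \/ T `<=` S.
Proof.
move=> hS hT VS VT; apply: contrapT => /not_orP[/existsNP[f /not_implyP[Sf Tf]]].
move=> /existsNP[g /not_implyP[Tg Sg]].
have f0 : f != 0 by apply/eqP => f0; apply: Tf; rewrite f0; exact: subring0.
have g0 : g != 0 by apply/eqP => g0; apply: Sg; rewrite g0; exact: subring0.
case: (valuation_total (f / g)) => h.
  by apply: Tf; rewrite -(divfK g0 f); apply: (subringM hT) => //; exact: VT.
apply: Sg; rewrite -(divfK f0 g); apply: (subringM hS) => //; apply: VS.
by rewrite -invf_div.
Qed.

End Valuation.
End Subrings.

(** * Limit ratios of values *)

Lemma fraction_between (R : realType) (x y : R) : x < y ->
  exists (a : int) (b : nat), x < a%:~R / b.+1%:R < y.
Proof.
move=> /rat_in_itvoo[q]; rewrite in_itv/= => qxy.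
exists (numq q), `|denq q|%N.-1; rewrite prednK ?absz_gt0 ?denq_neq0//.
by rewrite natr_absz ger0_norm ?denq_ge0// -/(ratr q).
Qed.

Section ValueRatio.
Context (R : realType) {K : fieldType} (V : set K) (c : K).

(* For a valuation [nu] with ring [V] this is the limit ratio [nu f / nu c]. *)
Definition value_ratio (f : K) : \bar R :=
  ereal_sup [set z | exists (a : int) (b : nat),
    V (f ^+ b.+1 * c ^ (- a)) /\ z = (a%:~R / b.+1%:R)%:E].

Lemma value_ratio_ge (a : int) (b : nat) f : V (f ^+ b.+1 * c ^ (- a)) ->
  ((a%:~R / b.+1%:R)%:E <= value_ratio f)%E.
Proof. by move=> h; apply: ereal_sup_ubound; exists a, b. Qed.

Hypotheses (hV : valuation_ring V) (c0 : c != 0) (cN : ~ V c^-1).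
Let sV := valuation_subring hV.

Lemma exprz_in_valuation (a : int) : V (c ^ a) -> 0 <= a.
Proof.
case: a => // n; rewrite NegzE -exprnN -exprVn => /(valuation_root hV).
by move=> /cN.
Qed.

(** Raise this membership and a competing one to each other's denominators: [f] cancels, and a power
    of [c] remains in [V], whose exponent, the difference of the cross products, must be
    nonnegative. *)
Lemma value_ratio_le (a : int) (b : nat) f : f != 0 ->
  V (c ^ a * f^-1 ^+ b.+1) -> (value_ratio f <= (a%:~R / b.+1%:R)%:E)%E.
Proof.
move=> f0 h; apply/ereal_supP => _ [a' [b' [h' ->]]].
rewrite lee_fin ler_pdivrMr ?ltr0n// mulrAC ler_pdivlMr ?ltr0n//.
rewrite !pmulrn -!intrM ler_int -subr_ge0; apply: exprz_in_valuation.
have := subringM sV (subringX sV b'.+1 h) (subringX sV b.+1 h').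
have f1 : f^-1 ^+ b.+1 ^+ b'.+1 * f ^+ b'.+1 ^+ b.+1 = 1.
  by rewrite -!exprM mulnC exprVn mulVf// expf_neq0.
rewrite !exprMn -mulrA (mulrA (_ ^+ _ ^+ _)) f1 mul1r.
by rewrite !exprnP !exprz_exp -expfzDr// mulNr.
Qed.

(** A converse of [value_ratio_ge] for strict inequalities: if the element is not in [V], its
    inverse is, and [value_ratio_le] bounds the supremum. *)
Lemma value_ratio_gt (a : int) (b : nat) f :
  ((a%:~R / b.+1%:R)%:E < value_ratio f)%E -> V (f ^+ b.+1 * c ^ (- a)).
Proof.
move=> h; case: (valuation_total hV (f ^+ b.+1 * c ^ (- a))) => // h'.
have [->|f0] := eqVneq f 0; first by rewrite expr0n mul0r; exact: subring0.
move: h; rewrite ltNge value_ratio_le//.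
by rewrite exprVn mulrC -{1}(opprK a) -invr_expz -invfM.
Qed.

Lemma value_ratio0 : value_ratio 0 = +oo%E.
Proof.
apply/eqyP => r _; have /fraction_between[a [b /andP[h _]]] : r < r + 1.
  by rewrite ltrDl.
apply: (@le_trans _ _ (a%:~R / b.+1%:R)%:E); first by rewrite lee_fin ltW.
by apply: value_ratio_ge; rewrite expr0n mul0r; exact: subring0.
Qed.

Lemma value_ratio_ge_int (a : int) f : V (f * c ^ (- a)) ->
  ((a%:~R : R)%:E <= value_ratio f)%E.
Proof. by rewrite -(divr1 (a%:~R : R)) => h; exact: (value_ratio_ge (b := 0)). Qed.

Lemma value_ratio_le_int (a : int) f : f != 0 -> V (c ^ a * f^-1) ->
  (value_ratio f <= (a%:~R : R)%:E)%E.
Proof.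
by rewrite -(divr1 (a%:~R : R)) => f0 h; exact: (value_ratio_le (b := 0)).
Qed.

Lemma value_ratio_ge0 f : V f -> (0 <= value_ratio f)%E.
Proof.
by move=> Vf; apply: (value_ratio_ge_int (a := 0)); rewrite oppr0 expr0z mulr1.
Qed.

Lemma value_ratio_unit f : V f -> V f^-1 -> f != 0 -> value_ratio f = 0%E.
Proof.
move=> Vf Vf' f0; apply/eqP; rewrite eq_le value_ratio_ge0// andbT.
by apply: (value_ratio_le_int (a := 0)) => //; rewrite expr0z mul1r.
Qed.

Lemma value_ratio1 : value_ratio 1 = 0%E.
Proof.
by apply: value_ratio_unit; rewrite ?invr1 ?oner_eq0//; exact: subring1.
Qed.

Lemma value_ratio_center : value_ratio c = 1%E.
Proof.
apply/eqP; rewrite eq_le (value_ratio_ge_int (a := 1)) ?(value_ratio_le_int (a := 1))//.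
- by rewrite expr1z divff//; exact: subring1.
- by rewrite -invr_expz expr1z divff//; exact: subring1.
Qed.

(** Memberships for [f] and [g] are raised to a common exponent and multiplied, which adds the
    fractions. The suprema are then taken one at a time by subtraction, so an infinite value of [g]
    is treated apart. *)
Lemma value_ratio_geM f g : (value_ratio f != -oo)%E -> (value_ratio g != -oo)%E ->
  (value_ratio f + value_ratio g <= value_ratio (f * g))%E.
Proof.
move=> fNy gNy.
have key (a a' : int) (b b' : nat) :
    V (f ^+ b.+1 * c ^ (- a)) -> V (g ^+ b'.+1 * c ^ (- a')) ->
    ((a%:~R / b.+1%:R + a'%:~R / b'.+1%:R)%:E <= value_ratio (f * g))%E.
  move=> h h'.
  have -> : a%:~R / b.+1%:R + a'%:~R / b'.+1%:R =
      (a * b'.+1%:Z + a' * b.+1%:Z)%:~R / ((b.+1 * b'.+1).-1).+1%:R :> R.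
    rewrite prednK ?muln_gt0// natrM !(intrD, intrM) -!pmulrn.
    have B0 : b.+1%:R != 0 :> R by rewrite pnatr_eq0.
    have B'0 : b'.+1%:R != 0 :> R by rewrite pnatr_eq0.
    by rewrite addf_div.
  apply: value_ratio_ge; rewrite prednK ?muln_gt0//.
  have := subringM sV (subringX sV b'.+1 h) (subringX sV b.+1 h').
  rewrite !exprMn -!exprM mulrACA (mulnC b'.+1) !exprnP !exprz_exp -expfzDr//.
  by rewrite -!exprnP !mulNr -opprD.
have [gy|gNpy] := eqVneq (value_ratio g) +oo%E.
  rewrite gy addey// leye_eq; apply/eqP/eqyP => r _.
  have : (-oo < value_ratio f)%E by rewrite ltNye.
  move=> /ereal_sup_gt[/= _ [a [b [h ->]]] _].
  have /fraction_between[a' [b' /andP[h' _]]] :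
    r - a%:~R / b.+1%:R < r - a%:~R / b.+1%:R + 1 by rewrite ltrDl.
  apply: le_trans (key a a' b b' h _); first by rewrite lee_fin -lerBlDl ltW.
  by apply: value_ratio_gt; rewrite gy ltry.
have gfin : value_ratio g \is a fin_num by rewrite fin_numE gNy.
rewrite -leeBrDr//; apply/ereal_supP => _ [a [b [h ->]]].
rewrite leeBrDr// addeC -leeBrDr//; apply/ereal_supP => _ [a' [b' [h' ->]]].
by rewrite leeBrDr// addeC -EFinD key.
Qed.

(** For a fraction below -r, failure of the membership for [f^-1] would be a membership for [f] with
    a fraction above [r]. The other inequality is superadditivity for f * f^-1 = 1. *)
Lemma value_ratioV f r : f != 0 -> value_ratio f = r%:E ->
  value_ratio f^-1 = (- r)%:E.
Proof.
move=> f0 fr; apply/eqP; rewrite eq_le; apply/andP; split; last first.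
  apply/lee_subgt0Pr => e e0.
  have /fraction_between[a [b /andP[h h']]] : - r - e < - r by lra.
  apply: (@le_trans _ _ (a%:~R / b.+1%:R)%:E); first by rewrite lee_fin ltW.
  apply: value_ratio_ge.
  case: (valuation_total hV (f^-1 ^+ b.+1 * c ^ (- a))) => // h2.
  have : (((- a)%:~R / b.+1%:R)%:E <= value_ratio f)%E.
    apply: value_ratio_ge; move: h2.
    by rewrite invfM exprVn invrK invr_expz.
  by rewrite fr lee_fin intrN mulNr lerNl leNgt h'.
have [->|fVNy] := eqVneq (value_ratio f^-1) -oo%E; first exact: leNye.
have := value_ratio_geM (f := f) (g := f^-1); rewrite fr divff//.
rewrite value_ratio1.
by move=> /(_ isT fVNy); rewrite addeC -leeBrDr// sub0e.
Qed.

(** The missing inequality is superadditivity for [f^-1] and [f * g], once the value of [f] is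
    finite. *)
Lemma value_ratioM f g : (value_ratio f != -oo)%E -> (value_ratio g != -oo)%E ->
  value_ratio (f * g) = (value_ratio f + value_ratio g)%E.
Proof.
move=> fNy gNy; have fg := value_ratio_geM fNy gNy.
have [fy|fNpy] := eqVneq (value_ratio f) +oo%E.
  by move: fg; rewrite fy addye// leye_eq => /eqP.
have fr : value_ratio f \is a fin_num by rewrite fin_numE fNy.
have f0 : f != 0 by apply/eqP => f0; rewrite f0 value_ratio0 in fNpy.
have fV := value_ratioV f0 (esym (fineK fr)).
apply/eqP; rewrite eq_le fg andbT.
have [->|fgNy] := eqVneq (value_ratio (f * g)) -oo%E; first exact: leNye.
have := @value_ratio_geM f^-1 (f * g); rewrite fV mulKf// => /(_ isT fgNy).
by rewrite EFinN fineK// addeC leeBlDl.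
Qed.

(** By symmetry [f / g] is in [V]; then [f + g] is [g] times an element of [V] and inherits every
    membership of [g]. *)
Lemma value_ratioD f g :
  (mine (value_ratio f) (value_ratio g) <= value_ratio (f + g))%E.
Proof.
wlog : f g / V (f / g).
  move=> wl; case: (valuation_total hV (f / g)) => [/wl//|].
  by rewrite invf_div => /wl; rewrite minC addrC.
have [->|g0] := eqVneq g 0; first by rewrite addr0 ge_min lexx.
move=> h; rewrite ge_min; apply/orP; right.
apply/ereal_supP => _ [a [b [h' ->]]]; apply: value_ratio_ge.
have -> : f + g = (f / g + 1) * g by rewrite mulrDl divfK// mul1r.
rewrite exprMn -mulrA; apply: (subringM sV) => //; apply: (subringX sV).
by apply: (subringD sV) => //; exact: subring1.
Qed.

Lemma value_ratioN f : value_ratio (- f) = value_ratio f.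
Proof.
have N1 g : (value_ratio g <= value_ratio (- g))%E.
  apply/ereal_supP => _ [a [b [h' ->]]]; apply: value_ratio_ge.
  rewrite exprNn -mulrA; apply: (subringM sV) => //; apply: (subringX sV).
  by apply: (subringN sV); exact: subring1.
by apply/eqP; rewrite eq_le N1 -{2}(opprK f) N1.
Qed.

Definition rank_one_ring : set K := [set f | 0 <= value_ratio f]%E.
(** For [c] as above this is [V] with [c] inverted: the value -oo occurs where no power of [c]
    clears the denominator. *)
Definition finite_ratio_ring : set K := [set f | value_ratio f != -oo]%E.

Lemma rank_one_finite_ratio : rank_one_ring `<=` finite_ratio_ring.
Proof. by move=> f f0; rewrite /finite_ratio_ring/= gt_eqF// (lt_le_trans _ f0). Qed.

Lemma sub_rank_one_ring : V `<=` rank_one_ring.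
Proof. by move=> f; exact: value_ratio_ge0. Qed.

Lemma rank_one_valuation_ring : valuation_ring rank_one_ring.
Proof.
apply: (overring_valuation hV) sub_rank_one_ring.
split => [|f g Sf Sg|f g Sf Sg]; first by apply: value_ratio_ge0; exact: subring1.
- apply: le_trans (value_ratioD _ _).
  by rewrite value_ratioN le_min Sf.
- have := value_ratioM (rank_one_finite_ratio Sf) (rank_one_finite_ratio Sg).
  by rewrite /rank_one_ring/= => ->; rewrite adde_ge0.
Qed.

Lemma finite_ratio_valuation_ring : valuation_ring finite_ratio_ring.
Proof.
apply: (overring_valuation hV) => [|f /sub_rank_one_ring/rank_one_finite_ratio//].
split => [|f g Sf Sg|f g Sf Sg]; rewrite /finite_ratio_ring/=.
- by apply: rank_one_finite_ratio; apply: sub_rank_one_ring; exact: subring1.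
- rewrite -ltNye; apply: lt_le_trans (value_ratioD _ _).
  by rewrite value_ratioN lt_min !ltNye; apply/andP.
- by rewrite value_ratioM// adde_eq_ninfty negb_or; apply/andP.
Qed.

(** An element of finite value has an inverse of opposite value, whereas +oo added to a value other
    than -oo is never 0, the value of 1. On the local ring this ideal is the kernel of the
    semivaluation. *)
Lemma finite_ratio_nonunitsE f :
  nonunits finite_ratio_ring f <-> value_ratio f = +oo%E.
Proof.
rewrite (valuation_nonunitsE finite_ratio_valuation_ring).
have [->|f0] := eqVneq f 0; first by split=> // _; [exact: value_ratio0|left].
split=> [[//|/negP]|fy].
- by move/eqP: f0.
- rewrite negbK => /eqP fV; apply/eqP; rewrite -leye_eq leNgt; apply/negP => fy.
  have [fN|fN] := eqVneq (value_ratio f) -oo%E.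
    case: (valuation_total hV f) => /value_ratio_ge0; rewrite ?fN ?fV//.
  have fr : value_ratio f \is a fin_num by rewrite fin_numE fN -ltey.
  by have := value_ratioV f0 (esym (fineK fr)); rewrite fV.
- right=> fV.
  have := value_ratioM (rank_one_finite_ratio (_ : rank_one_ring f)) fV.
  rewrite divff// fy addye// value_ratio1.
  by rewrite /rank_one_ring/= fy leey => /(_ isT).
Qed.

Lemma rank_one_center : ~ rank_one_ring c^-1.
Proof.
by rewrite /rank_one_ring/= (value_ratioV c0 value_ratio_center) lee_fin; lra.
Qed.

Lemma finite_ratio_center : finite_ratio_ring c^-1.
Proof. by rewrite /finite_ratio_ring/= (value_ratioV c0 value_ratio_center). Qed.

(* [rank_one_ring] is the largest overring in which [c] is not a unit and
   [finite_ratio_ring] the smallest one in which it is. *)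
Lemma rank_one_ring_max T : valuation_ring T -> V `<=` T -> ~ T c^-1 ->
  T `<=` rank_one_ring.
Proof.
move=> hT VT TcN f Tf.
(* A multiple of the nonunit [c] by an element of [T] is a nonunit of [T], hence lies in [V]. So the
   value of [f] is at least -1/n for every positive n. *)
have Vfc n : V (f ^+ n * c).
  apply: nonunits_sub; apply: (overring_nonunits hV hT VT).
  apply: (valuation_nonunitsM hT); first exact: (subringX (valuation_subring hT)).
  by apply/(valuation_nonunitsE hT); right.
rewrite /rank_one_ring/=; apply/lee_subgt0Pr => e /ltr_add_invr[b].
rewrite add0r sub0e => be; rewrite -EFinN.
apply: (@le_trans _ _ (((- 1 : int)%:~R / b.+1%:R)%:E)).
  by rewrite lee_fin intrN mulN1r lerN2 ltW.
by apply: value_ratio_ge; rewrite opprK expr1z.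
Qed.

Lemma finite_ratio_ring_min T : valuation_ring T -> V `<=` T -> T c^-1 ->
  finite_ratio_ring `<=` T.
Proof.
move=> hT VT Tc f; rewrite /finite_ratio_ring/= -ltNye.
move=> /ereal_sup_gt[/= _ [a [b [h ->]]] _].
have sT := valuation_subring hT.
apply: (valuation_root hT (n := b)).
have cz z : T (c ^ z).
  case: z => n; first by apply: subringX => //; case: (valuation_total hV c) => // /VT.
  by rewrite NegzE -exprnN -exprVn; exact: subringX.
rewrite -(mulr1 (f ^+ _)) -(expr0z c) -(addNr a) expfzDr// mulrA.
by apply: (subringM sT) => //; exact: VT.
Qed.

End ValueRatio.

(** * Chevalley's extension theorem *)

Section Chevalley.
Context {K : fieldType}.
Implicit Types (R J B : set K) (p q : {poly K}).

Definition is_ideal R J :=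
  [/\ J 0, forall f g, J f -> J g -> J (f + g),
      forall a f, R a -> J f -> J (a * f) & J `<=` R].

Definition coefs_in R p := forall i, R p`_i.
(** Also applied to an ideal J of [R], where it is the extension of J to R[x]. *)
Definition adjoin R (x : K) : set K := [set p.[x] | p in coefs_in R].

Lemma coefs_inB R p q : is_subring R ->
  coefs_in R p -> coefs_in R q -> coefs_in R (p - q).
Proof. by move=> sR hp hq i; rewrite coefB; apply: (subringB sR). Qed.

Lemma coefs_inM R p q : is_subring R ->
  coefs_in R p -> coefs_in R q -> coefs_in R (p * q).
Proof.
move=> sR hp hq i; rewrite coefM; apply: (subring_sum sR) => j _.
exact: (subringM sR).
Qed.

Lemma coefs_inC R a : is_subring R -> R a -> coefs_in R a%:P.
Proof. by move=> sR Ra i; rewrite coefC; case: eqP => // _; exact: subring0. Qed.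

Lemma coefs_inX R n : is_subring R -> coefs_in R 'X^n.
Proof.
by move=> sR i; rewrite coefXn; case: eqP => _; [exact: subring1|exact: subring0].
Qed.

Lemma ideal_sum R J (hJ : is_ideal R J) (I : Type) (r : seq I) (P : pred I)
    (F : I -> K) : (forall i, P i -> J (F i)) -> J (\sum_(i <- r | P i) F i).
Proof. by case: hJ => J0 JD _ _ JF; elim/big_ind: _. Qed.

Lemma adjoin_subring R x : is_subring R -> is_subring (adjoin R x).
Proof.
move=> sR; split=> [|_ _ [p hp <-] [q hq <-]|_ _ [p hp <-] [q hq <-]].
- by exists 1; rewrite ?hornerC// -polyC1; apply: coefs_inC => //; exact: subring1.
- by exists (p - q); [exact: coefs_inB|rewrite hornerD hornerN].
- by exists (p * q); [exact: coefs_inM|rewrite hornerM].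
Qed.

Lemma sub_adjoin R x : is_subring R -> R `<=` adjoin R x.
Proof. by move=> sR a Ra; exists a%:P; [exact: coefs_inC|rewrite hornerC]. Qed.

Lemma adjoin_gen R x : is_subring R -> adjoin R x x.
Proof.
by move=> sR; exists 'X; [rewrite -['X]expr1; exact: coefs_inX|rewrite hornerX].
Qed.

Lemma adjoin_ideal R J x : is_subring R -> is_ideal R J ->
  is_ideal (adjoin R x) (adjoin J x).
Proof.
move=> sR hJ; have [J0 JD JM JR] := hJ; split.
- by exists 0; rewrite ?horner0// => i; rewrite coef0.
- move=> _ _ [p hp <-] [q hq <-]; exists (p + q); rewrite ?hornerD// => i.
  by rewrite coefD; exact: JD.
- move=> _ _ [p hp <-] [q hq <-]; exists (p * q); rewrite ?hornerM// => i.
  by rewrite coefM; apply: (ideal_sum hJ) => j _; exact: JM.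
- by move=> _ [p hp <-]; exists p => // i; exact: JR.
Qed.

Section Domination.
Context {B : set K} (sB : is_subring B) (idealB : is_ideal B (nonunits B)).

(* A subset of [K * bool] encodes a pair of a subring and an ideal of it, so that
   Zorn's lemma for inclusion applies to such pairs. *)
Let ring_part (A : set (K * bool)) : set K := [set f | A (f, true)].
Let ideal_part (A : set (K * bool)) : set K := [set f | A (f, false)].
Let dominating (A : set (K * bool)) :=
  [/\ is_subring (ring_part A), B `<=` ring_part A,
      is_ideal (ring_part A) (ideal_part A), nonunits B `<=` ideal_part A
    & ~ ideal_part A 1].

Lemma maximal_dominating_pair : exists A, dominating A /\
  forall A', A `<=` A' -> dominating A' -> A' `<=` A.
Proof.
have [F FP Ftot|A [PA Amax]] := @Zorn_bigcup _ [set A | A = set0 \/ dominating A].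
  have [[X0 FX0 X0n]|none] := pselect (exists2 X, F X & X !=set0); last first.
    left; apply/seteqP; split=> // z [X FX Xz]; case: none; exists X => //.
    by exists z.
  have good X z : F X -> X z -> dominating X.
    by move=> /FP[->|//].
  have join X Y z1 z2 : F X -> F Y -> X z1 -> Y z2 ->
      exists Z, [/\ F Z, dominating Z, Z z1 & Z z2].
    move=> FX FY Xz Yz; case: (Ftot X Y FX FY) => XY.
      by exists Y; split=> //; [exact: good Yz|exact: XY].
    by exists X; split=> //; [exact: good Xz|exact: XY].
  case: X0n => z0 /(good _ _ FX0)[[X1 XB XM] BX [X00 _ _ _] MX N1].
  right; split.
  - split; first by exists X0.
    + move=> f g [X FX Xf] [Y FY Yg].
      have [Z [FZ [[_ ZB _] _ _ _ _] Zf Zg]] := join _ _ _ _ FX FY Xf Yg.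
      by exists Z => //; exact: ZB.
    + move=> f g [X FX Xf] [Y FY Yg].
      have [Z [FZ [[_ _ ZM] _ _ _ _] Zf Zg]] := join _ _ _ _ FX FY Xf Yg.
      by exists Z => //; exact: ZM.
  - by move=> f /BX ?; exists X0.
  - split; first by exists X0.
    + move=> f g [X FX Xf] [Y FY Yg].
      have [Z [FZ [_ _ [_ ZD _ _] _ _] Zf Zg]] := join _ _ _ _ FX FY Xf Yg.
      by exists Z => //; exact: ZD.
    + move=> f g [X FX Xf] [Y FY Yg].
      have [Z [FZ [_ _ [_ _ ZM _] _ _] Zf Zg]] := join _ _ _ _ FX FY Xf Yg.
      by exists Z => //; exact: ZM.
    + move=> f [X FX Xf]; have [_ _ [_ _ _ XR] _ _] := good _ _ FX Xf.
      by exists X => //; exact: XR.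
  - by move=> f /MX ?; exists X0.
  - by move=> [X FX Xf]; have [_ _ _ _] := good _ _ FX Xf.
pose A0 : set (K * bool) := [set z | if z.2 then B z.1 else nonunits B z.1].
have gA0 : dominating A0.
  split=> //=.
  move=> /nonunitsE[_ []]; first by apply/eqP; exact: oner_neq0.
  by rewrite invr1; case: sB.
have {}PA : dominating A.
  case: PA => [A_0|//]; exfalso; apply: (Amax A0); last by right.
  rewrite A_0; split=> // /(_ (1, true)); apply.
  exact: (subring1 sB).
exists A; split=> // A' AA' gA'; apply: contrapT => A'A.
by apply: (Amax A'); [split|right].
Qed.

Lemma dominating_valuation_ring : exists V, [/\ valuation_ring V, B `<=` V
  & nonunits V `&` B = nonunits B].
Proof.
have [A [[sR BR hJ MJ J1] Amax]] := maximal_dominating_pair.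
set R := ring_part A in sR BR hJ; set J := ideal_part A in hJ MJ J1.
have [J0 JD JM JR] := hJ.
(* By maximality, J R[f] is the unit ideal for every [f] outside [R]; otherwise R[f] with this ideal
   would be a larger pair. *)
have ext f : ~ R f -> adjoin J f 1.
  move=> Rf; apply: contrapT => N1; apply: Rf.
  pose A' : set (K * bool) := [set z | if z.2 then adjoin R f z.1 else adjoin J f z.1].
  have AA' : A `<=` A'.
    move=> [z [|]] Az; rewrite /A'/=; first exact: sub_adjoin.
    exists z%:P; last by rewrite hornerC.
    by move=> i; rewrite coefC; case: eqP.
  apply: (Amax A' AA'); last exact: (adjoin_gen f sR).
  split=> //=; first exact: adjoin_subring.
  - by move=> g /BR Rg; apply: AA'.
  - exact: adjoin_ideal.
  - by move=> g /MJ Rg; apply: (AA' (g, false)).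
(* Otherwise a relation for the inverse of 1 - b, multiplied by (1 - b)^(size p), puts that power in
   [J]. As (1 - b)^(n+1) = (1 - b)^n - b (1 - b)^n, the exponent can be lowered until 1 is in
   [J]. *)
have unit b : J b -> 1 - b != 0 /\ R (1 - b)^-1.
  move=> Jb; have b1 : 1 - b != 0.
    by apply/eqP => /eqP; rewrite subr_eq0 => /eqP b1; apply: J1; rewrite b1.
  split=> //; apply: contrapT => /ext[p hp /(congr1 (fun z => z * (1 - b) ^+ size p))].
  rewrite mul1r horner_coef mulr_suml => p1.
  have Rb : R (1 - b) by apply: (subringB sR); [exact: (subring1 sR)|exact: JR].
  have : J ((1 - b) ^+ size p).
    rewrite -p1; apply: (ideal_sum hJ) => i _; rewrite -mulrA mulrC.
    apply: JM => //; rewrite exprVn mulrC.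
    by rewrite -expfB//; exact: (subringX sR).
  elim: (size p) => [//|n IH]; rewrite exprS mulrBl mul1r => h; apply: IH.
  rewrite -(subrK (b * (1 - b) ^+ n) ((1 - b) ^+ n)); apply: JD => //.
  by rewrite mulrC; apply: JM => //; exact: (subringX sR).
(* Let n be the degree of [p]. Multiplying q(f^-1) = 1 by f^n expresses (1 - q_0) f^n through lower
   powers of [f]; as 1 - q_0 is invertible, this replaces the leading term of [p]. *)
have descent f p q : f != 0 -> coefs_in J p -> coefs_in J q ->
    p.[f] = 1 -> q.[f^-1] = 1 -> (size q <= size p)%N ->
    exists p', [/\ coefs_in J p', p'.[f] = 1 & (size p' < size p)%N].
  move=> f0 hp hq pf qf.
  have [b1 Rb1] := unit _ (hq 0).
  have p0 : p != 0 by apply: contra_eq_neq pf => ->; rewrite horner0 eq_sym oner_eq0.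
  case sp : (size p) => [|n]; first by move/eqP: sp; rewrite size_poly_eq0 (negbTE p0).
  move=> qn; pose d := p`_n / (1 - q`_0).
  exists (\poly_(i < n) (p`_i + d * q`_(n - i))); split.
  - move=> i; rewrite coef_poly; case: ifP => // _; apply: JD => //.
    by apply: JM => //; apply: (subringM sR) => //; exact: JR.
  - rewrite horner_poly -[RHS]pf horner_coef sp big_ord_recr/=.
    under eq_bigr do rewrite mulrDl.
    rewrite big_split/=; congr (_ + _).
    transitivity (d * (f ^+ n * (1 - q`_0))); last by rewrite mulrCA /d divfK// mulrC.
    rewrite -{1}qf (horner_coef_wide _ qn) big_ord_recl/= expr0 mulr1 addrAC subrr add0r.
    rewrite !mulr_sumr (reindex_inj rev_ord_inj)/=; apply: eq_bigr => i _.
    rewrite subKn// -mulrA; congr (_ * _); rewrite mulrCA; congr (_ * _).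
    by rewrite /bump leq0n add1n exprVn -expfB_cond ?(negbTE f0) ?ltn_ord.
  - by rewrite ltnS size_poly.
(* Descent on the total size: the longer relation is shortened, with [f] and [f^-1] exchanged when
   it is the one for [f^-1]. *)
have no_relation n f p q : f != 0 -> coefs_in J p -> coefs_in J q ->
    p.[f] = 1 -> q.[f^-1] = 1 -> (size p + size q <= n)%N -> False.
  elim: n f p q => [|n IH] f p q f0 hp hq pf qf spq.
    have /eqP : size p = 0 by apply/eqP; move: spq; rewrite leqn0 addn_eq0 => /andP[].
    by rewrite size_poly_eq0 => /eqP p0; move/eqP: pf; rewrite p0 horner0 eq_sym oner_eq0.
  case: (leqP (size q) (size p)) => sqp.
    have [p' [hp' pf' sp']] := descent _ _ _ f0 hp hq pf qf sqp.
    apply: (IH f p' q) => //; rewrite -ltnS; apply: leq_trans spq.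
    by rewrite ltn_add2r.
  have [q' [hq' qf' sq']] : exists q', [/\ coefs_in J q', q'.[f^-1] = 1
      & (size q' < size q)%N].
    by apply: (descent _ q p) => //; rewrite ?invr_eq0 ?invrK// ltnW.
  apply: (IH f p q') => //; rewrite -ltnS; apply: leq_trans spq.
  by rewrite ltn_add2l.
exists R; split=> //.
  case: (sR) => R1 RB RM; split=> // f f0.
  apply: contrapT => /not_orP[/ext[p hp pf] /ext[q hq qf]].
  exact: (no_relation _ f p q).
apply/seteqP; split=> f.
  move=> [/nonunitsE[Rf fN] Bf]; apply/nonunitsE; split=> //.
  by case: fN => [|fN]; [left|right=> /BR].
move=> fN; have [Bf _] := fN; split=> //; apply/nonunitsE; split; first exact: BR.
have [->|f0] := eqVneq f 0; [by left|right=> Rf].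
by apply: J1; rewrite -(mulVf f0); apply: JM => //; exact: MJ.
Qed.

End Domination.
End Chevalley.

(** * Hilbert's basis theorem *)

Section HilbertBasis.
Context {K : fieldType}.
Implicit Types (A I J : set K) (p q : {poly K}).

(** Generation of [I] by [s] is expressed through the ideals containing [s], which avoids writing
    linear combinations. *)
Definition noetherian A := forall I, is_ideal A I ->
  exists2 s : seq K, (forall g, g \in s -> I g) &
    forall J, is_ideal A J -> (forall g, g \in s -> J g) -> I `<=` J.

Lemma ideal_setI A I J : is_ideal A I -> is_ideal A J -> is_ideal A (I `&` J).
Proof.
move=> [I0 ID IM IA] [J0 JD JM JA]; split=> //.
- by move=> f g [? ?] [? ?]; split; [exact: ID|exact: JD].
- by move=> a f Aa [? ?]; split; [exact: IM|exact: JM].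
- by move=> f [/IA].
Qed.

Context {A : set K} (sA : is_subring A) (x : K).

(** Leading coefficients are taken over the preimage of [I] in the polynomial ring: [x] may be
    algebraic over [A], so elements of [adjoin A x] have no degree of their own. *)
Let lead (I : set K) (d : nat) : set K := [set p`_d | p in
  [set p | [/\ coefs_in A p, (size p <= d.+1)%N & I p.[x]]]].

Lemma lead_ideal I d : is_ideal (adjoin A x) I -> is_ideal A (lead I d).
Proof.
case=> I0 ID IM IA; split.
- exists 0; last by rewrite coef0.
  by split; rewrite ?size_poly0 ?horner0// => i; rewrite coef0; exact: subring0.
- move=> _ _ [p [hp sp Ip] <-] [q [hq sq Iq] <-]; exists (p + q); last by rewrite coefD.
  split; rewrite ?hornerD//; last exact: ID.
    by move=> i; rewrite coefD; apply: (subringD sA).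
  by rewrite (leq_trans (size_polyD _ _))// geq_max sp.
- move=> a _ Aa [p [hp sp Ip] <-]; exists (a *: p); last by rewrite coefZ.
  split; rewrite ?hornerZ//; last by apply: IM => //; exact: sub_adjoin.
    by move=> i; rewrite coefZ; apply: (subringM sA).
  by rewrite (leq_trans (size_scale_leq _ _)).
- by move=> _ [p [hp _ _] <-].
Qed.

Lemma lead_nondecreasing I d e : is_ideal (adjoin A x) I -> (d <= e)%N ->
  lead I d `<=` lead I e.
Proof.
move=> [_ _ IM _] /subnK <-; elim: (e - d)%N => [//|n IH] a /IH[p [hp sp Ip] <-].
exists (p * 'X); last by rewrite coefMX addSn.
split.
- by apply: coefs_inM => //; rewrite -['X]expr1; exact: coefs_inX.
- by rewrite (leq_trans (size_polyMleq _ _))// size_polyX addn2.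
- by rewrite hornerMX mulrC; apply: IM => //; exact: adjoin_gen.
Qed.

(** Converts generators of a leading ideal into elements of [I]: each is the value at [x] of a
    polynomial that realizes one of the coefficients. *)
Lemma lead_lift I d (t : seq K) : (forall a, a \in t -> lead I d a) ->
  exists2 G : seq K, (forall g, g \in G -> I g) &
    forall J, (forall g, g \in G -> J g) -> forall a, a \in t -> lead J d a.
Proof.
elim: t => [|a t IH] ht; first by exists [::].
have [|G GI GJ] := IH; first by move=> b bt; apply: ht; rewrite in_cons bt orbT.
have [p [hp sp Ip] pa] := ht a (mem_head _ _).
exists (p.[x] :: G) => [g|J hJ b]; rewrite in_cons => /orP[/eqP->//|].
- exact: GI.
- by exists p => //; split=> //; apply: hJ; rewrite mem_head.
- by apply: GJ => g gG; apply: hJ; rewrite in_cons gG orbT.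
Qed.

Lemma noetherian_adjoin : noetherian A -> noetherian (adjoin A x).
Proof.
move=> nA I hI; have [I0 ID IM IA] := hI.
have /choice[s hs] d : exists s : seq K, (forall g, g \in s -> lead I d g) /\
    forall J, is_ideal A J -> (forall g, g \in s -> J g) -> lead I d `<=` J.
  by have [s ? ?] := nA _ (lead_ideal d hI); exists s.
have hlim : is_ideal A (\bigcup_d lead I d).
  split.
  - by exists 0 => //; case: (lead_ideal 0 hI).
  - move=> f g [d _ hf] [e _ hg]; exists (maxn d e) => //.
    case: (lead_ideal (maxn d e) hI) => _ + _ _; apply.
      exact: (lead_nondecreasing hI (leq_maxl d e)).
    exact: (lead_nondecreasing hI (leq_maxr d e)).
  - by move=> a f Aa [d _ hf]; exists d => //; case: (lead_ideal d hI) => _ _ + _; apply.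
  - by move=> f [d _ hf]; case: (lead_ideal d hI) => _ _ _; apply.
have [t tlim tgen] := nA _ hlim.
(* The leading ideals increase with the degree, so all generators of their union occur in one degree
   [D]. Up to [D], the finitely many lists [s d] are lifted to [G]. *)
have [D hD] : exists D, forall g, g \in t -> lead I D g.
  elim: t {tgen} tlim => [|a t IH] ht; first by exists 0.
  have [|D hD] := IH; first by move=> b bt; apply: ht; rewrite in_cons bt orbT.
  have [d _ ad] := ht a (mem_head _ _).
  exists (maxn d D) => g; rewrite in_cons => /orP[/eqP->|/hD gD].
    exact: (lead_nondecreasing hI (leq_maxl d D)).
  exact: (lead_nondecreasing hI (leq_maxr d D)).
have [G GI GJ] : exists2 G : seq K, (forall g, g \in G -> I g) &
    forall J, (forall g, g \in G -> J g) ->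
    forall d, (d < D.+1)%N -> forall a, a \in s d -> lead J d a.
  elim: D.+1 => [|n [G GI GJ]]; first by exists [::].
  have [G' G'I G'J] := lead_lift (hs n).1.
  exists (G ++ G') => [g|J hJ d]; first by rewrite mem_cat => /orP[/GI|/G'I].
  rewrite ltnS leq_eqVlt => /orP[/eqP->|dn].
    by apply: G'J => g gG; apply: hJ; rewrite mem_cat gG orbT.
  by apply: GJ => // g gG; apply: hJ; rewrite mem_cat gG.
exists G => // J hJ JG.
(* Working with the intersection keeps the polynomial subtracted below inside [I], so that the
   induction on the degree can continue there. *)
have hIJ := ideal_setI hI hJ.
have leadIJ d : lead I d `<=` lead (I `&` J) d.
  have small e : (e < D.+1)%N -> lead I e `<=` lead (I `&` J) e.
    move=> eD; apply: (hs e).2; first exact: lead_ideal.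
    by apply: GJ => // g gG; split; [exact: GI|exact: JG].
  case: (ltnP d D.+1) => [|dD]; first exact: small.
  apply: (@subset_trans _ (\bigcup_d lead I d)); first by move=> a ?; exists d.
  apply: tgen; first exact: lead_ideal.
  move=> g /hD /(small _ (ltnSn D)); apply: (lead_nondecreasing hIJ).
  exact: ltnW.
suff key d p : coefs_in A p -> (size p <= d)%N -> I p.[x] -> (I `&` J) p.[x].
  move=> f If; have [p hp pf] := IA _ If.
  by rewrite -pf in If *; have [] := key _ _ hp (leqnn _) If.
elim: d p => [|d IH] p hp sp Ip.
  move: sp; rewrite leqn0 size_poly_eq0 => /eqP ->; rewrite horner0.
  by case: hIJ.
have [q [hq sq Iq] pq] : lead (I `&` J) d p`_d by apply: leadIJ; exists p.
rewrite -(subrK q p) hornerD.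
have [_ IJD _ _] := hIJ; apply: IJD => //; apply: IH.
- exact: coefs_inB.
- apply/leq_sizeP => j; rewrite leq_eqVlt coefB => /orP[/eqP <-|dj].
    by rewrite pq subrr.
  by rewrite !nth_default ?subrr//; [exact: leq_trans dj|exact: leq_trans dj].
- rewrite hornerD hornerN; apply: ID => //.
  rewrite -mulN1r; apply: IM; last by case: Iq.
  by apply: sub_adjoin => //; apply: (subringN sA); exact: (subring1 sA).
Qed.

End HilbertBasis.

Lemma noetherian_field (k K : fieldType) (iota : {rmorphism k -> K}) :
  noetherian (range iota).
Proof.
move=> I [I0 ID IM IA].
have [[f If f0]|none] := pselect (exists2 f, I f & f != 0).
  exists [:: 1] => [g|J [_ _ JM JA] /(_ 1 (mem_head _ _)) J1 g /IA kg].
    rewrite mem_seq1 => /eqP ->; rewrite -(mulVf f0); apply: IM => //.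
    by have [c _ <-] := IA _ If; exists c^-1 => //; rewrite fmorphV.
  by rewrite -(mulr1 g); exact: JM.
exists [::] => // J [J0 _ _ _] _ g Ig; have [->//|g0] := eqVneq g 0.
by case: none; exists g.
Qed.

Lemma range_subring (k K : fieldType) (iota : {rmorphism k -> K}) :
  is_subring (range iota).
Proof.
split=> [|_ _ [a _ <-] [b _ <-]|_ _ [a _ <-] [b _ <-]].
- by exists 1 => //; exact: rmorph1.
- by exists (a - b) => //; exact: rmorphB.
- by exists (a * b) => //; exact: rmorphM.
Qed.

Fixpoint adjoin_seq (K : fieldType) (A : set K) (xs : seq K) : set K :=
  if xs is x :: xs' then adjoin (adjoin_seq A xs') x else A.

Section AdjoinSeq.
Context {K : fieldType}.
Implicit Types (A B : set K) (xs : seq K).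

Lemma adjoin_seq_subring A xs : is_subring A -> is_subring (adjoin_seq A xs).
Proof. by move=> sA; elim: xs => //= x xs; exact: adjoin_subring. Qed.

Lemma sub_adjoin_seq A xs : is_subring A -> A `<=` adjoin_seq A xs.
Proof.
move=> sA; elim: xs => //= x xs IH; apply: (subset_trans IH).
by apply: sub_adjoin; exact: adjoin_seq_subring.
Qed.

Lemma mem_adjoin_seq A xs x : is_subring A -> x \in xs -> adjoin_seq A xs x.
Proof.
move=> sA; elim: xs => //= y xs IH; have sAxs := adjoin_seq_subring xs sA.
by rewrite in_cons => /orP[/eqP ->|/IH]; [exact: adjoin_gen|exact: sub_adjoin].
Qed.

Lemma adjoin_seq_min A B xs : is_subring B -> A `<=` B ->
  (forall x, x \in xs -> B x) -> adjoin_seq A xs `<=` B.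
Proof.
move=> sB AB; elim: xs => //= x xs IH hx _ [p hp <-].
rewrite horner_coef; apply: (subring_sum sB) => i _; apply: (subringM sB).
  by apply: IH => // y yxs; apply: hx; rewrite in_cons yxs orbT.
by apply: (subringX sB); apply: hx; rewrite mem_head.
Qed.

Lemma noetherian_adjoin_seq A xs : is_subring A -> noetherian A ->
  noetherian (adjoin_seq A xs).
Proof.
move=> sA nA; elim: xs => //= x xs IH; apply: noetherian_adjoin => //.
exact: adjoin_seq_subring.
Qed.

End AdjoinSeq.

(** * Finiteness of the rank *)

Section Monomials.
Context {k K : fieldType} (e : {rmorphism k -> K}).
Implicit Types (s : seq K) (f g : K).

Definition linear_span s : set K :=
  [set f | exists a : nat -> k, f = \sum_(i < size s) e (a i) * s`_i].

Lemma linear_span0 s : linear_span s 0.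
Proof. by exists (fun=> 0); rewrite big1// => i _; rewrite rmorph0 mul0r. Qed.

Lemma linear_spanD s f g : linear_span s f -> linear_span s g -> linear_span s (f + g).
Proof.
move=> [a ->] [b ->]; exists (fun i => a i + b i).
by rewrite -big_split/=; apply: eq_bigr => i _; rewrite rmorphD mulrDl.
Qed.

Lemma linear_spanZ s c f : linear_span s f -> linear_span s (e c * f).
Proof.
move=> [a ->]; exists (fun i => c * a i).
by rewrite mulr_sumr; apply: eq_bigr => i _; rewrite rmorphM mulrA.
Qed.

Lemma linear_span_sum s (I : Type) (r : seq I) (P : pred I) (F : I -> K) :
  (forall i, P i -> linear_span s (F i)) -> linear_span s (\sum_(i <- r | P i) F i).
Proof.
by move=> sF; elim/big_ind: _ => //; [exact: linear_span0|exact: linear_spanD].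
Qed.

Lemma mem_linear_span s f : f \in s -> linear_span s f.
Proof.
move=> fs; exists (fun i => (i == index f s)%:R).
have fi : (index f s < size s)%N by rewrite index_mem.
rewrite (bigD1 (Ordinal fi))//= eqxx rmorph1 mul1r nth_index// big1 ?addr0// => i.
by rewrite -val_eqE/= => /negbTE ->; rewrite rmorph0 mul0r.
Qed.

(** The matrix of coefficients has more rows than columns, so its left kernel contains a nonzero
    row. *)
Lemma linear_span_dependent s (I : finType) (y : I -> K) : (size s < #|I|)%N ->
  (forall i, linear_span s (y i)) ->
  exists2 u : I -> k, exists i, u i != 0 & \sum_i e (u i) * y i = 0.
Proof.
move=> sI /choice[a ya].
pose M : 'M[k]_(#|I|, size s) := \matrix_(i, j) a (enum_val i) j.
have kerN0 : kermx M != 0.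
  rewrite kermx_eq0; apply/negP => /eqP Mfree.
  by have := rank_leq_col M; rewrite Mfree leqNgt sI.
pose v := nz_row (kermx M).
have vM : v *m M = 0 by apply/sub_kermxP; exact: nz_row_sub.
have /rV0Pn[i vi] : v != 0 by rewrite nz_row_eq0.
exists (fun i => v 0 (enum_rank i)); first by exists (enum_val i); rewrite enum_valK.
rewrite (eq_bigl (fun i => i \in I))//.
rewrite big_enum_val/=.
under eq_bigr do rewrite enum_valK ya mulr_sumr.
rewrite exchange_big/= big1// => j _.
under eq_bigr do rewrite mulrA -rmorphM/=.
rewrite -mulr_suml -rmorph_sum/=.
have /rowP/(_ j) := vM; rewrite !mxE => vMj.
rewrite (_ : \sum_i _ = 0) ?rmorph0 ?mul0r// -[RHS]vMj.
by apply: eq_bigr => l _; rewrite mxE.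
Qed.

(** The degree is bounded in each variable separately, so that the length of the list is exactly
    (D+1)^n. *)
Fixpoint monomials (xs : seq K) (D : nat) : seq K :=
  if xs is x :: xs' then [seq x ^+ i * m | i <- seq.iota 0 D.+1, m <- monomials xs' D]
  else [:: 1].

Lemma monomials_cons x xs D : monomials (x :: xs) D =
  [seq x ^+ i * m | i <- seq.iota 0 D.+1, m <- monomials xs D].
Proof. by []. Qed.

Lemma size_monomials xs D : size (monomials xs D) = (D.+1 ^ size xs)%N.
Proof.
elim: xs => // x xs IH.
by rewrite monomials_cons size_allpairs size_iota IH expnS.
Qed.

Lemma monomials_nondecreasing xs D E : (D <= E)%N ->
  {subset monomials xs D <= monomials xs E}.
Proof.
move=> DE; elim: xs => // x xs IH m.
rewrite !monomials_cons => /allpairsP[[i n] [iD nD ->]].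
apply/allpairsP; exists (i, n); split=> //; last exact: IH.
by move: iD; rewrite !mem_iota !add0n/= !ltnS => /leq_trans; apply.
Qed.

Lemma monomialsM xs D E m n : m \in monomials xs D -> n \in monomials xs E ->
  m * n \in monomials xs (D + E).
Proof.
elim: xs m n => [m n|x xs IH m n].
  by rewrite !mem_seq1 => /eqP -> /eqP ->; rewrite mulr1.
rewrite !monomials_cons => /allpairsP[[i m'] [iD mD ->]] /allpairsP[[j n'] [jE nE ->]].
apply/allpairsP; exists ((i + j)%N, m' * n'); split; [|exact: IH|].
  move: iD jE; rewrite !mem_iota !add0n/= !ltnS; exact: leq_add.
by rewrite exprD mulrACA.
Qed.

Lemma monomials1 xs : 1 \in monomials xs 0.
Proof.
elim: xs => [|x xs IH]; first by rewrite mem_seq1.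
by rewrite monomials_cons; apply/allpairsP; exists (0%N, 1); split=> //; rewrite mulr1.
Qed.

Lemma mem_monomials xs x : x \in xs -> x \in monomials xs 1.
Proof.
elim: xs => // y xs IH; rewrite in_cons monomials_cons.
move=> /orP[/eqP ->|xxs]; apply/allpairsP.
  exists (1%N, 1); split=> //; last by rewrite mulr1.
  exact: (monomials_nondecreasing _ (monomials1 xs)).
by exists (0%N, x); split; rewrite ?mul1r//; exact: IH.
Qed.

Section DegreeFiltration.
Variable xs : seq K.

Definition deg_le (D : nat) : set K := linear_span (monomials xs D).

Lemma deg_le_nondecreasing D E : (D <= E)%N -> deg_le D `<=` deg_le E.
Proof.
move=> DE _ [a ->]; apply: linear_span_sum => i _; apply: linear_spanZ.
by apply: mem_linear_span; apply: (monomials_nondecreasing DE); exact: mem_nth.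
Qed.

Lemma deg_leM D E f g : deg_le D f -> deg_le E g -> deg_le (D + E) (f * g).
Proof.
move=> [a ->] [b ->]; rewrite mulr_suml; apply: linear_span_sum => i _.
rewrite mulr_sumr; apply: linear_span_sum => j _.
rewrite mulrACA -rmorphM; apply: linear_spanZ; apply: mem_linear_span.
by apply: monomialsM; exact: mem_nth.
Qed.

Lemma deg_le_const c : deg_le 0 (e c).
Proof.
rewrite -(mulr1 (e c)); apply: linear_spanZ; apply: mem_linear_span.
exact: monomials1.
Qed.

Lemma deg_leX D f n : deg_le D f -> deg_le (D * n) (f ^+ n).
Proof.
move=> hf; elim: n => [|n IH]; first by
  rewrite muln0 expr0 -(rmorph1 e); exact: deg_le_const.
by rewrite mulnS exprS; exact: deg_leM.
Qed.

Lemma deg_le_prod m (F : 'I_m -> K) D : (forall i, deg_le D (F i)) ->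
  deg_le (m * D) (\prod_i F i).
Proof.
elim: m F => [|m IH] F hF.
  by rewrite big_ord0 -(rmorph1 e); exact: deg_le_const.
by rewrite big_ord_recl mulSn; apply: deg_leM => //; exact: IH.
Qed.

Lemma deg_le_subring : is_subring (\bigcup_D deg_le D).
Proof.
split=> [|f g [D _ fD] [E _ gE]|f g [D _ fD] [E _ gE]].
- by exists 0 => //; rewrite -(rmorph1 e); exact: deg_le_const.
- exists (maxn D E) => //; apply: linear_spanD.
    exact: (deg_le_nondecreasing (leq_maxl D E)).
  rewrite -mulN1r -(rmorph1 e) -rmorphN; apply: linear_spanZ.
  exact: (deg_le_nondecreasing (leq_maxr D E)).
- by exists (D + E)%N => //; exact: deg_leM.
Qed.

Lemma adjoin_seq_deg_le : adjoin_seq (range e) xs `<=` \bigcup_D deg_le D.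
Proof.
apply: adjoin_seq_min; first exact: deg_le_subring.
  by move=> _ [c _ <-]; exists 0 => //; exact: deg_le_const.
move=> x xxs; exists 1 => //; apply: mem_linear_span; exact: mem_monomials.
Qed.

End DegreeFiltration.
End Monomials.

Section RankBound.
Context {k K : fieldType} (e : {rmorphism k -> K}).

Definition is_unit (S : set K) (f : K) : Prop := [/\ f != 0, S f & S f^-1].

Lemma is_unitM S f g : is_subring S -> is_unit S f -> is_unit S g -> is_unit S (f * g).
Proof.
move=> sS [f0 Sf Sf'] [g0 Sg Sg']; split; rewrite ?mulf_neq0 ?invfM//.
  exact: (subringM sS).
exact: (subringM sS).
Qed.

Lemma is_unitV S f : is_unit S f -> is_unit S f^-1.
Proof. by case=> *; split; rewrite ?invr_eq0 ?invrK. Qed.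

Lemma is_unitX S f n : is_subring S -> is_unit S f -> is_unit S (f ^+ n).
Proof.
move=> sS [f0 Sf Sf']; split; rewrite ?expf_neq0// -?exprVn; exact: (subringX sS).
Qed.

Lemma is_unit1 S : is_subring S -> is_unit S 1.
Proof. by move=> sS; split; rewrite ?oner_eq0 ?invr1//; exact: (subring1 sS). Qed.

Lemma is_unit_prod S (I : Type) (r : seq I) (P : pred I) (F : I -> K) :
  is_subring S -> (forall i, P i -> is_unit S (F i)) ->
  is_unit S (\prod_(i <- r | P i) F i).
Proof.
by move=> sS SF; elim/big_ind: _ => //; [exact: is_unit1|move=> *; exact: is_unitM].
Qed.

Section Independence.
Context {V : set K} (hV : valuation_ring V) (eV : forall a, V (e a)).
Context {m N : nat} (C : 'I_m -> set K) (t : 'I_m -> K).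
Hypotheses (hC : forall i, valuation_ring (C i)) (VC : forall i, V `<=` C i).
Hypotheses (t0 : forall i, t i != 0) (tN : forall i, ~ C i (t i)^-1).
Hypothesis tU : forall i j : 'I_m, (i < j)%N -> is_unit (C i) (t j).

Let T (alpha : {ffun 'I_m -> 'I_N.+1}) : K := \prod_i t i ^+ alpha i.

Let T_neq0 alpha : T alpha != 0.
Proof. by apply/prodf_neq0 => i _; rewrite expf_neq0. Qed.

(** Let i be the least index where the exponents differ. Earlier factors cancel and later [t j] are
    units of [C i], so the quotient is a unit of [C i] times a nonzero power of the nonunit [t i];
    it is not a unit of [C i], let alone of [V]. *)
Lemma monomial_values_distinct alpha beta : alpha != beta ->
  ~ is_unit V (T alpha / T beta).
Proof.
move=> ab.
have [i0 i0P] : exists i, alpha i != beta i.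
  apply/existsP; rewrite -negb_forall; apply: contra ab => /forallP h.
  by apply/eqP/ffunP => i; apply/eqP.
case: (@arg_minnP _ i0 (fun i => alpha i != beta i) val i0P) => i iP imin {i0 i0P}.
wlog lti : alpha beta ab iP imin / (beta i < alpha i)%N.
  move=> wl; move: iP; rewrite neq_ltn => /orP[|]/= ltab; last first.
    by apply: (wl alpha beta) => //; rewrite neq_ltn ltab orbT.
  move=> /is_unitV; rewrite invf_div; apply: (wl beta alpha) => //.
  - by rewrite eq_sym.
  - by rewrite neq_ltn ltab orbT.
  - by move=> j /=; rewrite eq_sym; exact: imin.
move=> [r0 Vr Vr'].
have sC := valuation_subring (hC i).
have : is_unit (C i) (T alpha / T beta) by split=> //; exact: VC.
rewrite -prodf_div (bigD1 i)//= => h.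
have rest : is_unit (C i) (\prod_(j | j != i) (t j ^+ alpha j / t j ^+ beta j)).
  apply: is_unit_prod => // j ji.
  have [->|abj] := eqVneq (alpha j) (beta j).
    by rewrite divff ?expf_neq0//; exact: is_unit1.
  have ij : (i < j)%N by rewrite ltn_neqAle imin// andbT eq_sym.
  by apply: is_unitM => //; [|apply: is_unitV]; apply: is_unitX => //; exact: tU.
have [r'0 _ _] := rest.
have := is_unitM sC h (is_unitV rest); rewrite mulfK// -expfB// => -[_ _].
by rewrite -exprVn -[(_ - _)%N]prednK ?subn_gt0// => /(valuation_root (hC i))/tN.
Qed.

(** Divide by the monomial of least value among those with nonzero coefficient. The other terms
    become nonunits because the values are distinct, while this one becomes a nonzero constant,
    which is a unit. *)
Lemma monomials_independent (u : {ffun 'I_m -> 'I_N.+1} -> k) :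
  \sum_alpha e (u alpha) * T alpha = 0 -> forall alpha, u alpha = 0.
Proof.
move=> uT alpha; apply/eqP; apply: contraT => ua.
have sV := valuation_subring hV.
pose ord (a b : {ffun 'I_m -> 'I_N.+1}) := `[< V (T b / T a) >].
case: (@extremumP _ _ ord alpha (fun a => u a != 0) id) => //.
- by move=> a; apply/asboolP; rewrite divff//; exact: (subring1 sV).
- move=> b a c /asboolP ab /asboolP bc; apply/asboolP.
  have -> : T c / T a = (T c / T b) * (T b / T a) by rewrite mulrA divfK.
  exact: (subringM sV).
- move=> a b; apply/orP; case: (valuation_total hV (T b / T a)) => h.
    by left; apply/asboolP.
  by right; apply/asboolP; rewrite -invf_div.
move=> b ub bmin.
have : nonunits V (\sum_(a | a != b) e (u a) * (T a / T b)).
  elim/big_ind: _ => [||a ab]; first by apply: nonunits0; exact: subring0.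
    exact: (valuation_nonunitsD hV).
  have [ua0|ua0] := eqVneq (u a) 0.
    by rewrite ua0 rmorph0 mul0r; apply: nonunits0; exact: subring0.
  apply: (valuation_nonunitsM hV) => //.
  apply/(valuation_nonunitsE hV); right=> h.
  have /asboolP h' := bmin a ua0.
  apply: (monomial_values_distinct ab); split=> //.
  by rewrite mulf_neq0 ?invr_eq0.
move: uT; rewrite (bigD1 b)//= => /(congr1 (fun z => z / T b)).
rewrite mulrDl mul0r mulfK// mulr_suml.
rewrite (eq_bigr (fun a => e (u a) * (T a / T b))); last by move=> a _; rewrite mulrA.
move=> /eqP; rewrite addrC addr_eq0 => /eqP ->.
move=> /(valuation_nonunitsE hV)[/eqP|].
  by rewrite oppr_eq0 fmorph_eq0 (negbTE ub).
by rewrite -rmorphN -fmorphV => /(_ (eV _)).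
Qed.

End Independence.

Context (xs : seq K).
Hypothesis fractions : forall f : K, exists p q,
  [/\ adjoin_seq (range e) xs p, adjoin_seq (range e) xs q, q != 0 & f * q = p].

(* The [(N+1)^(n+1)] monomials of degree at most [N] in each [t i] are linearly
   independent and, up to a common denominator, lie in a space of dimension at
   most [(c N + 1)^n]. *)
Lemma rank_bound (C : 'I_(size xs).+1 -> set K) (V : set K) :
  valuation_ring V -> (forall a, V (e a)) ->
  (forall i, valuation_ring (C i)) -> (forall i, V `<=` C i) ->
  (forall i j : 'I_(size xs).+1, (i <= j)%N -> C j `<=` C i) ->
  ~ (forall i, exists f, ~ C i f /\ forall j : 'I_(size xs).+1, (j < i)%N -> C j f).
Proof.
set m := (size xs).+1 => hV eV hC VC Cmono /choice[f hf].
have f0 i : f i != 0.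
  apply/eqP => fi0; case: (hf i) => + _; apply; rewrite fi0.
  by apply: subring0; exact: valuation_subring.
(* The inverses of the [f i] will be the independent elements; they are written as fractions with
   numerator and denominator of bounded degree. *)
have /choice[pq hpq] : forall i, exists pq : K * K, exists D,
    [/\ deg_le e xs D pq.1, deg_le e xs D pq.2, pq.2 != 0 & (f i)^-1 * pq.2 = pq.1].
  move=> i; have [p [q [/adjoin_seq_deg_le[D _ pD] /adjoin_seq_deg_le[E _ qE] q0 fpq]]] :=
    fractions (f i)^-1.
  exists (p, q), (maxn D E); split=> //=.
    exact: (deg_le_nondecreasing (leq_maxl D E)).
  exact: (deg_le_nondecreasing (leq_maxr D E)).
have /choice[d hd] := hpq.
pose D := (\max_i d i)%N.
have pD i : deg_le e xs D (pq i).1.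
  by have [h _ _ _] := hd i; apply: (deg_le_nondecreasing _ h); exact: leq_bigmax.
have qD i : deg_le e xs D (pq i).2.
  by have [_ h _ _] := hd i; apply: (deg_le_nondecreasing _ h); exact: leq_bigmax.
(* With n = size xs and m = n + 1, this choice gives (m D N + 1)^n <= (m D + 1)^n (N + 1)^n = N (N +
   1)^n < (N + 1)^(n+1), so the monomials outnumber the dimension. *)
pose N := ((m * D).+1 ^ size xs)%N.
(* A monomial in the inverses of the [f i], multiplied by the common denominator, the product of all
   [(pq i).2 ^+ N]. *)
pose y (a : {ffun 'I_m -> 'I_N.+1}) := \prod_i ((pq i).1 ^+ a i * (pq i).2 ^+ (N - a i)).
have yE a : y a = (\prod_i (f i)^-1 ^+ a i) * \prod_i (pq i).2 ^+ N.
  rewrite -big_split/=; apply: eq_bigr => i _; have [_ _ _ <-] := hd i.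
  rewrite exprMn -mulrA -exprD subnKC//; exact: (leq_ord (a i)).
have yD a : deg_le e xs (m * (D * N)) (y a).
  apply: deg_le_prod => i; have aN := leq_ord (a i).
  have -> : (D * N = D * a i + D * (N - a i))%N by rewrite -mulnDr subnKC.
  by apply: deg_leM; exact: deg_leX.
have [|u [a ua] uy] := linear_span_dependent _ yD.
  rewrite size_monomials card_ffun !card_ord.
  apply: (@leq_ltn_trans (((m * D).+1 * N.+1) ^ size xs)%N).
    case: (size xs) => [//|n]; rewrite leq_exp2r// mulnA mulSn mulnS addSn ltnS.
    by rewrite addnA leq_addl.
  by rewrite expnMn expnS ltn_mul2r expn_gt0/= /N.
have Q0 : \prod_i (pq i).2 ^+ N != 0.
  by apply/prodf_neq0 => i _; have [_ _ q0 _] := hd i; rewrite expf_neq0.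
(* As [f i] is not in [C i], its inverse is a nonunit there. For i < j, [C i] contains [f j] by
   assumption and its inverse through [C j], so the latter is a unit of [C i]. *)
have := @monomials_independent V hV eV m N C (fun i => (f i)^-1) hC VC _ _ _ u.
move=> /(_ _ _ _ _ a) ua0; move/eqP: ua; apply; apply: ua0.
- by move=> i; rewrite invr_eq0.
- by move=> i; rewrite invrK; case: (hf i).
- move=> i j ij; split; rewrite ?invr_eq0 ?invrK//; last by case: (hf j) => _; apply.
  apply: (Cmono i j (ltnW ij)); have [fj _] := hf j.
  by case: (valuation_total (hC j) (f j)).
- apply: (mulIf Q0); rewrite mul0r -[RHS]uy mulr_suml; apply: eq_bigr => b _.
  by rewrite yE mulrA.
Qed.

End RankBound.

Section Overrings.
Context {K : fieldType} {V : set K} (hV : valuation_ring V).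

Definition proper_overring (T : set K) : Prop :=
  [/\ valuation_ring T, V `<=` T & T <> setT].

(** Sorting by this relation puts the largest ring first, the order required by
    [is_maximal_chain]. *)
Let ge (S T : set K) : bool := `[< T `<=` S >].

Lemma sort_overrings (s : seq (set K)) : (forall T, T \in s -> proper_overring T) ->
  sorted ge (sort ge s).
Proof.
move=> hs; apply: (@sort_sorted_in _ (mem s)); last exact/allP.
move=> S T /hs[hS VS _] /hs[hT VT _]; apply/orP.
case: (overring_total hV (valuation_subring hS) (valuation_subring hT) VS VT) => h.
  by right; apply/asboolP.
by left; apply/asboolP.
Qed.

Let ge_trans : transitive ge.
Proof.
move=> S T U /asboolP h /asboolP h'; apply/asboolP; exact: subset_trans h' h.
Qed.

Lemma nth_sort_overrings s i j : (forall T, T \in s -> proper_overring T) ->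
  (i <= j < size s)%N -> nth setT (sort ge s) j `<=` nth setT (sort ge s) i.
Proof.
move=> hs /andP[]; rewrite leq_eqVlt => /predU1P[->|ij] js; first exact: subset_refl.
apply/asboolP.
have i_s := ltn_trans ij js.
apply: (sorted_ltn_nth ge_trans setT (sort_overrings hs)) ij.
  by rewrite unfold_in/= size_sort.
by rewrite unfold_in/= size_sort.
Qed.

Context {k : fieldType} (e : {rmorphism k -> K}) (xs : seq K).
Hypothesis fractions : forall f : K, exists p q,
  [/\ adjoin_seq (range e) xs p, adjoin_seq (range e) xs q, q != 0 & f * q = p].
Hypothesis eV : forall a, V (e a).

(** For each ring of the sorted list, pick an element of the preceding ring outside it; for the
    first one the preceding ring is K, as overrings here are proper. A longer list would contradict
    [rank_bound]. *)
Lemma overring_count (s : seq (set K)) : (forall T, T \in s -> proper_overring T) ->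
  uniq s -> (size s <= size xs)%N.
Proof.
move=> hs us; rewrite leqNgt; apply/negP => xss.
pose C (i : 'I_(size xs).+1) := nth setT (sort ge s) i.
have ls (i : 'I_(size xs).+1) : (i < size s)%N by apply: leq_trans (ltn_ord i) xss.
have hC i : proper_overring (C i).
  by apply: hs; rewrite -(mem_sort ge) mem_nth// size_sort.
apply: (@rank_bound k K e xs fractions C V hV eV).
- by move=> i; have [] := hC i.
- by move=> i; have [] := hC i.
- by move=> i j ij; apply: nth_sort_overrings => //; rewrite ij ls.
move=> i; have [i0|i0] := posnP i.
  have [_ _ /eqP/setTPn[f hf]] := hC i; exists f; split=> // j.
  by rewrite i0.
have i1 : (i.-1 < i)%N by rewrite prednK.
have [f hf hf'] : exists2 f, nth setT (sort ge s) i.-1 f & ~ C i f.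
  apply: contrapT => none.
  have : nth setT (sort ge s) i.-1 = C i.
    apply/seteqP; split; last by apply: nth_sort_overrings => //; rewrite ltnW//= ls.
    by move=> f hf; apply: contrapT => hf'; apply: none; exists f.
  move/eqP; rewrite nth_uniq ?sort_uniq ?size_sort//; last exact: ltn_trans (ls i).
  by rewrite ltn_eqF.
exists f; split=> // j ji; apply: (nth_sort_overrings hs _ hf).
by rewrite -ltnS prednK// ji ltnW// ls.
Qed.

(** Lists of distinct proper overrings have bounded length, so a longest one contains all of them;
    sorted, and with indices shifted to start at 1, it is the chain. *)
Lemma maximal_chain_exists : V <> setT -> exists r C, is_maximal_chain V r C.
Proof.
move=> VT.
pose P n := `[< exists s : seq (set K), [/\ forall T, T \in s -> proper_overring T,
  uniq s & size s = n] >].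
have P0 : exists n, P n by exists 0%N; apply/asboolP; exists [::].
have Pbound n : P n -> (n <= size xs)%N.
  by move=> /asboolP[s [hs us <-]]; exact: overring_count.
case: (ex_maxnP P0 Pbound) => r /asboolP[s [hs us sr]] rmax.
have all_s T : proper_overring T -> T \in s.
  move=> hT; apply: contraT => Ts.
  have /rmax : P r.+1.
    apply/asboolP; exists (T :: s); split; rewrite /= ?Ts ?sr//.
    by move=> U; rewrite in_cons => /predU1P[->|/hs].
  by rewrite ltnn.
have Vs : V \in s by apply: all_s; split.
have r1 : (1 <= r)%N by rewrite -sr; case: (s) Vs.
pose C i := nth setT (sort ge s) i.-1.
have hC i : (1 <= i <= r)%N -> proper_overring (C i).
  case: i => // i /= ir; apply: hs; rewrite -(mem_sort ge) mem_nth//.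
  by rewrite size_sort sr.
exists r, C; split=> //.
- have [_ VC _] := hC r ltac:(by rewrite r1 leqnn).
  apply/seteqP; split=> //.
  rewrite -[X in _ `<=` X](nth_index setT (_ : V \in sort ge s)) ?mem_sort//.
  apply: nth_sort_overrings => //; rewrite sr prednK// leqnn andbT -ltnS prednK//.
  by rewrite -sr -(size_sort ge) index_mem mem_sort.
- by move=> i /hC[].
- case=> // i /= ir; split.
    by apply: nth_sort_overrings => //; rewrite leqnSn sr.
  move=> h; have : C i.+2 = C i.+1.
    apply/seteqP; split=> //; apply: nth_sort_overrings => //.
    by rewrite leqnSn sr.
  move/eqP; rewrite nth_uniq ?sort_uniq ?size_sort ?sr//; last exact: ltnW.
  by rewrite gtn_eqF.
- move=> T hT VT' TT; have Ts : T \in s by exact: all_s.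
  exists (index T (sort ge s)).+1; last by rewrite /C/= nth_index// mem_sort.
  by rewrite /= -sr -(size_sort ge) index_mem mem_sort.
Qed.

End Overrings.

(** * Residue fields *)

Section ResidueField.
Context {K : fieldType} {T : set K} (hT : valuation_ring T).
Let sT := valuation_subring hT.

Definition in_ring : {pred K} := [pred f | `[< T f >]].

Lemma in_ring_closed : subring_closed in_ring.
Proof.
split=> [|f g /asboolP Tf /asboolP Tg|f g /asboolP Tf /asboolP Tg]; apply/asboolP.
- exact: (subring1 sT).
- exact: (subringB sT).
- exact: (subringM sT).
Qed.

HB.instance Definition _ := GRing.isSubringClosed.Build K in_ring in_ring_closed.

Record ring_elt := RingElt { elt_val :> K; _ : elt_val \in in_ring }.
HB.instance Definition _ := [isSub for elt_val].
HB.instance Definition _ := [Choice of ring_elt by <:].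
HB.instance Definition _ := [SubChoice_isSubComNzRing of ring_elt by <:].

Definition in_maximal : {pred ring_elt} := [pred f | `[< nonunits T (elt_val f) >]].

Lemma in_maximal_closed : idealr_closed in_maximal.
Proof.
split.
- by apply/asboolP; apply: nonunits0; exact: (subring0 sT).
- apply/negP => /asboolP /(valuation_nonunitsE hT)[/eqP|].
    by rewrite oner_eq0.
  by rewrite invr1; apply; exact: (subring1 sT).
- move=> [a aT] f g /asboolP hf /asboolP hg; apply/asboolP.
  apply: (valuation_nonunitsD hT) hg; apply: (valuation_nonunitsM hT) hf.
  exact/asboolP.
Qed.

HB.instance Definition _ := isIdealr.Build ring_elt in_maximal in_maximal_closed.

Definition residue_field_sort : Type := {ideal_quot in_maximal}.
HB.instance Definition _ := GRing.ComNzRing.on residue_field_sort.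

Definition residue_class (f : ring_elt) : residue_field_sort :=
  \pi_({ideal_quot in_maximal})%qT f.

Lemma residue_classD f g : residue_class (f + g) = residue_class f + residue_class g.
Proof. exact: Quotient.pi_add. Qed.

Lemma residue_classM f g : residue_class (f * g) = residue_class f * residue_class g.
Proof. exact: Quotient.pi_mul. Qed.

Lemma residue_class1 : residue_class 1 = 1.
Proof. by rewrite /residue_class [RHS]piE. Qed.

Lemma residue_class_eq0 f : (residue_class f = 0) <-> nonunits T (elt_val f).
Proof.
have zE : 0 = residue_class 0 by rewrite /residue_class [LHS]piE.
suff : (residue_class f == 0) = (f \in in_maximal).
  move=> h; split=> [/eqP|fN]; first by rewrite h => /asboolP.
  by apply/eqP; rewrite h; exact/asboolP.
by rewrite zE -Quotient.idealrBE subr0.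
Qed.

Lemma residue_class_surj q : exists f, q = residue_class f.
Proof. by exists (repr q); rewrite /residue_class reprK. Qed.

Lemma residue_inverse_exists (q : residue_field_sort) :
  exists q', if q == 0 then q' = 0 else q' * q = 1.
Proof.
case: eqP => [_|q0]; first by exists 0.
have [f qf] := residue_class_surj q.
have [Tf fT] : T (elt_val f) /\ (elt_val f) != 0 /\ T (elt_val f)^-1 .
  have /asboolP Tf := valP f; split=> //.
  by apply: not_nonunits => // fN; apply: q0; rewrite qf; apply/residue_class_eq0.
have fT' : (elt_val f)^-1 \in in_ring by apply/asboolP; case: fT.
exists (residue_class (RingElt fT')); rewrite qf -residue_classM -residue_class1.
by congr residue_class; apply/val_inj => /=; rewrite mulVf//; case: fT.
Qed.

Definition residue_inv (q : residue_field_sort) : residue_field_sort :=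
  sval (cid (residue_inverse_exists q)).

Lemma residue_mulVf q : q != 0 -> residue_inv q * q = 1.
Proof. by rewrite /residue_inv; case: cid => q' /=; case: eqP. Qed.

Lemma residue_inv0 : residue_inv 0 = 0.
Proof. by rewrite /residue_inv; case: cid => q' /=; rewrite eqxx. Qed.

HB.instance Definition _ :=
  GRing.ComNzRing_isField.Build residue_field_sort residue_mulVf residue_inv0.

Definition reduction (f : K) : residue_field_sort :=
  if insub f is Some g then residue_class g else 0.

Lemma reductionE (f : K) (Tf : f \in in_ring) : reduction f = residue_class (RingElt Tf).
Proof. by rewrite /reduction insubT. Qed.

Lemma is_residue_field_reduction : is_residue_field T reduction.
Proof.
have inT f : T f -> f \in in_ring by move=> ?; apply/asboolP.
split.
- rewrite (reductionE (inT 1 (subring1 sT))) -residue_class1.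
  by congr residue_class; exact/val_inj.
- move=> f g Tf Tg.
  rewrite (reductionE (inT _ (subringD sT Tf Tg)))
    (reductionE (inT _ Tf)) (reductionE (inT _ Tg)).
  by rewrite -residue_classD; congr residue_class; exact/val_inj.
- move=> f g Tf Tg.
  rewrite (reductionE (inT _ (subringM sT Tf Tg)))
    (reductionE (inT _ Tf)) (reductionE (inT _ Tg)).
  by rewrite -residue_classM; congr residue_class; exact/val_inj.
- apply/seteqP; split=> // q _; have [[f fT] qf] := residue_class_surj q.
  by exists f; [exact/asboolP|rewrite (reductionE fT)].
- by move=> f Tf; rewrite (reductionE (inT _ Tf)) residue_class_eq0.
Qed.

End ResidueField.

Lemma residue_field_exists (K : fieldType) (T : set K) : valuation_ring T ->
  exists (L : fieldType) (red : K -> L), is_residue_field T red.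
Proof. by move=> hT; eexists; eexists; exact: (is_residue_field_reduction hT). Qed.

(** * Real valuations and the limit ratio *)

Lemma fraction_between_ereal (R : realType) (x y : \bar R) : (x < y)%E ->
  exists (a : int) (b : nat), (x < (a%:~R / b.+1%:R)%:E < y)%E.
Proof.
case: x y => [x||] [y||]//.
- rewrite lte_fin => /fraction_between[a [b h]].
  by exists a, b; rewrite !lte_fin.
- move=> _; have /fraction_between[a [b /andP[h _]]] : x < x + 1 by rewrite ltrDl.
  by exists a, b; rewrite lte_fin h ltry.
- move=> _; have /fraction_between[a [b /andP[_ h]]] : y - 1 < y by rewrite ltrBlDl ltrDr.
  by exists a, b; rewrite lte_fin h ltNyr.
- by move=> _; exists 0, 0%N; rewrite ltNyr ltry.
Qed.

Section Characterization.
Context (R : realType) {K : fieldType} {V : set K} (hV : valuation_ring V).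
Context {c : K} (c0 : c != 0) (cN : ~ V c^-1).
Let sV := valuation_subring hV.
Local Notation W := (value_ratio R V c).

(** Nothing is asked about fractions equal to [y], for which membership may go either way; the
    density of the fractions still determines the value. *)
Lemma value_ratio_unique (y : \bar R) f :
  (forall (a : int) b, V (f ^+ b.+1 * c ^ (- a)) -> ((a%:~R / b.+1%:R)%:E <= y)%E) ->
  (forall (a : int) b, ((a%:~R / b.+1%:R)%:E < y)%E -> V (f ^+ b.+1 * c ^ (- a))) ->
  W f = y.
Proof.
move=> h1 h2; apply/eqP; rewrite eq_le; apply/andP; split.
  by apply/ereal_supP => _ [a [b [h ->]]]; exact: h1.
rewrite leNgt; apply/negP => /fraction_between_ereal[a [b /andP[Wab /h2 ab]]].
by move: Wab; rewrite ltNge (value_ratio_ge _ ab).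
Qed.

Lemma value_ratio_eqy f : (forall n, V (f * c ^- n)) -> W f = +oo%E.
Proof.
move=> h; apply/eqyP => r _.
have := archi_boundP (normr_ge0 r); set m := Num.bound _ => rm.
apply: (@le_trans _ _ ((m : int)%:~R)%:E).
  by rewrite lee_fin (le_trans (ler_norm _))// ltW.
by apply: value_ratio_ge_int; rewrite -exprnN.
Qed.

(* [phi] is a valuation on the units of an overring of [S], with ring [S]. *)
Lemma value_ratio_real (S U : set K) (phi : K -> R) :
  valuation_ring S -> V `<=` S -> is_subring U ->
  (forall f g, is_unit U f -> is_unit U g -> phi (f * g) = phi f + phi g) ->
  (forall f, is_unit U f -> S f <-> 0 <= phi f) ->
  is_unit U c -> 0 < phi c ->
  forall f, is_unit U f -> W f = (phi f / phi c)%:E.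
Proof.
move=> hS VS sU phiM phiS Uc phic f Uf.
have phi1 : phi 1 = 0.
  have := phiM _ _ (is_unit1 sU) (is_unit1 sU).
  by rewrite mulr1 => h; apply: (@addrI _ (phi 1)); rewrite addr0.
have phiV g : is_unit U g -> phi g^-1 = - phi g.
  move=> Ug; apply/eqP; rewrite -addr_eq0 -phiM//; last exact: is_unitV.
  by rewrite mulVf ?phi1//; case: Ug.
have phiX g n : is_unit U g -> phi (g ^+ n) = n%:R * phi g.
  move=> Ug; elim: n => [|n IH]; first by rewrite mul0r.
  by rewrite exprS phiM ?IH//; [rewrite -natr1 mulrDl mul1r addrC|exact: is_unitX].
have phiZ g (a : int) : is_unit U g -> is_unit U (g ^ a) /\ phi (g ^ a) = a%:~R * phi g.
  move=> Ug; case: a => n; first by split; [exact: is_unitX|rewrite phiX].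
  have Un := is_unitX n.+1 sU Ug.
  rewrite NegzE -exprnN; split; first exact: is_unitV.
  by rewrite phiV// phiX// intrN mulNr.
have key (a : int) b : is_unit U (f ^+ b.+1 * c ^ (- a)) /\
    phi (f ^+ b.+1 * c ^ (- a)) = b.+1%:R * phi f - a%:~R * phi c.
  have [Uca phica] := phiZ c (- a) Uc; have Ufb := is_unitX b.+1 sU Uf.
  by split; [exact: is_unitM|rewrite phiM// phiX// phica intrN mulNr].
apply: value_ratio_unique => a b.
  have [Ux phix] := key a b.
  move=> /VS /(phiS _ Ux); rewrite phix subr_ge0 => h.
  by rewrite lee_fin ler_pdivlMr// mulrAC ler_pdivrMr ?ltr0n// (mulrC (phi f)).
rewrite lte_fin ltr_pdivlMr// mulrAC ltr_pdivrMr ?ltr0n// (mulrC (phi f)) => h.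
have [Ux phix] := key a b.
(* [phi] is strictly positive here, so the element is a nonunit of [S]; this puts it in [V], which
   may be smaller than [S]. *)
apply: nonunits_sub; apply: (overring_nonunits hV hS VS).
apply/(valuation_nonunitsE hS); right=> /(phiS _ (is_unitV Ux)).
by rewrite phiV// phix oppr_ge0 leNgt subr_gt0 h.
Qed.

Lemma real_valuation_fine (L : fieldType) (w : L -> \bar R) (S : set L) :
  real_valuation w S ->
  [/\ forall f g, f != 0 -> g != 0 -> fine (w (f * g)) = fine (w f) + fine (w g)
    & forall f, f != 0 -> S f <-> 0 <= fine (w f)].
Proof.
move=> [w0 wfin wM wD <-]; split=> [f g f0 g0|f f0].
  by rewrite wM fineD ?wfin.
by rewrite /= -lee_fin fineK ?wfin.
Qed.

End Characterization.

Section ResidueValuation.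
Context (R : realType) {K : fieldType} {V : set K} (hV : valuation_ring V).
Context {c : K} (c0 : c != 0) (cN : ~ V c^-1).
Local Notation W := (value_ratio R V c).
Local Notation S := (rank_one_ring R V c).
Local Notation T := (finite_ratio_ring R V c).

Lemma value_ratio_real_valuation : T = setT -> real_valuation W S.
Proof.
move=> TT; have Wfin f : (W f != -oo)%E by change (T f); rewrite TT.
split=> //.
- exact: value_ratio0.
- move=> f f0; rewrite fin_numE Wfin; apply/eqP => /(finite_ratio_nonunitsE R hV c0 cN).
  move=> /(valuation_nonunitsE (finite_ratio_valuation_ring R hV c0 cN))[/eqP|].
    by rewrite (negbTE f0).
  by rewrite TT; apply.
- by move=> f g; exact: value_ratioM.
- by move=> f g; exact: value_ratioD.
Qed.

Context {L : fieldType} {red : K -> L} (hred : is_residue_field T red).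

Definition residue_ratio (l : L) : \bar R := W (xget 0 [set f | T f /\ red f = l]).

(** Two lifts differ by an element of the maximal ideal, whose ratio is +oo, so the ultrametric
    inequality compares their ratios in both directions. *)
Lemma residue_ratioE f : T f -> residue_ratio (red f) = W f.
Proof.
have hT := finite_ratio_valuation_ring R hV c0 cN.
have sT := valuation_subring hT.
have le g h : T g -> T h -> red g = red h -> (W g <= W h)%E.
  move=> Tg Th gh; have [_ redD _ _ redE] := hred.
  have Thg : T (h - g) by exact: (subringB sT).
  have : red (h - g) = 0.
    by apply: (@addIr _ (red g)); rewrite -redD// subrK add0r gh.
  move=> /(redE _ Thg)/(finite_ratio_nonunitsE R hV c0 cN) hgy.
  have := value_ratioD R c hV (h - g) g.
  by rewrite subrK hgy min_r// leey.
move=> Tf; rewrite /residue_ratio; case: xgetP => [g -> [Tg gf]|/(_ f)]; last first.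
  by case.
by apply/eqP; rewrite eq_le !le.
Qed.

Lemma residue_ratio_real_valuation : real_valuation residue_ratio (red @` S).
Proof.
have hT := finite_ratio_valuation_ring R hV c0 cN.
have sT := valuation_subring hT.
have ST := @rank_one_finite_ratio R K V c.
have [_ redD redM redT redE] := hred.
have lift l : exists2 f, T f & red f = l.
  by have : setT l by []; rewrite -redT => -[f Tf <-]; exists f.
split.
- have T0 := subring0 sT.
  have <- : red 0 = 0 by apply/(redE _ T0)/(nonunits0 T0).
  by rewrite residue_ratioE// value_ratio0.
- move=> l; have [f Tf <-] := lift l => f0.
  rewrite residue_ratioE// fin_numE; apply/andP; split; first exact: Tf.
  apply: contra_neq f0 => fy; apply/(redE _ Tf).
  exact/(finite_ratio_nonunitsE R hV c0 cN).
- move=> l l'; have [f Tf <-] := lift l; have [g Tg <-] := lift l'.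
  rewrite -redM// !residue_ratioE//; last exact: (subringM sT).
  exact: value_ratioM.
- move=> l l'; have [f Tf <-] := lift l; have [g Tg <-] := lift l'.
  rewrite -redD// !residue_ratioE//; last exact: (subringD sT).
  exact: value_ratioD.
- apply/seteqP; split=> l /=.
    by have [f Tf <-] := lift l; rewrite residue_ratioE// => Sf; exists f.
  by move=> [f Sf <-]; rewrite residue_ratioE//; exact: ST.
Qed.

End ResidueValuation.

(** * The image of a valuation *)

Section CenterParameter.
Context {k : fieldType} {X : space_over k} {K : fieldType}.
Context {F : function_field X K} {x : X}.
Local Notation O := (local_ring_set F x).
Implicit Types (V T : set K) (c : K).

Lemma local_ring_subring : is_subring O.
Proof.
have [h1 hB hM] := local_ring_closed F x.
by split.
Qed.

Lemma constant_local_ring (a : k) : O (constant_function F a).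
Proof.
apply/asboolP; exists setT, (open_nbhs_setT _), (open_nbhs_setT _).
by exists (structure_map X a).
Qed.

Definition constant_morphism : {rmorphism k -> K} :=
  germ (generic_stalk F) (open_nbhs_setT (generic_point F)) \o structure_map X.

Lemma constant_functionV (a : k) :
  (constant_function F a)^-1 = constant_function F a^-1.
Proof. exact/esym/(fmorphV constant_morphism). Qed.

Lemma constant_function_eq0 (a : k) : (constant_function F a == 0) = (a == 0).
Proof. exact: (fmorph_eq0 constant_morphism). Qed.

Definition center_parameter V c : Prop :=
  [/\ nonunits O c, c != 0 & forall g, nonunits O g -> V (g / c)].

Section Centered.
Context {V : set K} (hV : valuation_ring V) (cV : centered F x V).

Lemma centered_sub_nonunits f : nonunits O f -> nonunits V f.
Proof. by case: cV => _ <- []. Qed.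

Lemma parameter_not_unit c : center_parameter V c -> ~ V c^-1.
Proof.
move=> [/centered_sub_nonunits cN c0 _].
by case/(valuation_nonunitsE hV): cN => // cE; rewrite cE eqxx in c0.
Qed.

(** Every [f] in the maximal ideal is (f / c) c with f / c in [V], so it is a nonunit of [T] as soon
    as [c] is. *)
Lemma centered_overring T c : center_parameter V c -> valuation_ring T -> V `<=` T ->
  centered F x T <-> ~ T c^-1.
Proof.
move=> hc hT VT; have [cm c0 cmin] := hc; split.
  move=> [_ TO]; have : nonunits T c by rewrite -TO in cm; case: cm.
  by move=> /(valuation_nonunitsE hT)[/eqP|//]; rewrite (negbTE c0).
move=> Tc; have [OV VO] := cV; split; first exact: subset_trans VT.
apply/seteqP; split=> f.
  by move=> [/(overring_nonunits hV hT VT) fN Of]; rewrite -VO.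
move=> fm; have [Of _] := fm; split=> //; rewrite -(divfK c0 f).
apply: (valuation_nonunitsM hT); first exact/VT/cmin.
by apply/(valuation_nonunitsE hT); right.
Qed.

End Centered.
End CenterParameter.

Section CanonicalImage.
Context {R : realType} {k : fieldType} {X : space_over k} {K : fieldType}.
Context {F : function_field X K} {x : X}.
Local Notation O := (local_ring_set F x).

Section Existence.
Context {V : set K} (hV : valuation_ring V) (cV : centered F x V).
Context {c : K} (hc : center_parameter (F := F) (x := x) V c).
Local Notation W := (value_ratio R V c).

Let c0 : c != 0. Proof. by case: hc. Qed.
Let cN : ~ V c^-1. Proof. exact: (parameter_not_unit hV cV hc). Qed.

Lemma value_ratio_center_min : is_minimum (W @` nonunits O) 1%E.
Proof.
have [cm _ cmin] := hc; split.
  by exists c => //; exact: value_ratio_center.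
move=> _ [g gm <-]; apply: (value_ratio_ge_int R (a := 1)).
by rewrite -invr_expz expr1z; exact: cmin.
Qed.

Lemma value_ratio_normalized :
  is_normalized_semivaluation (fun f : local_ring F x => W (regular_fun f)).
Proof.
have sV := valuation_subring hV; have [OV _] := cV.
have inV (f : local_ring F x) : V (regular_fun f) by apply: OV; exact: (valP f).
have Wge0 (f : local_ring F x) : (0 <= W (regular_fun f))%E by exact: value_ratio_ge0.
split=> //; split.
- exact: value_ratio0.
- move=> a f a0 ->; apply: (value_ratio_unit _ hV c0 cN).
  + exact/OV/constant_local_ring.
  + by rewrite constant_functionV; exact/OV/constant_local_ring.
  + by rewrite constant_function_eq0.
- move=> f g; apply: (value_ratioM hV c0 cN); apply: rank_one_finite_ratio; exact: Wge0.
- by move=> f g; exact: value_ratioD.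
- have [[g gm gc] cmin] := value_ratio_center_min; split.
    by exists (LocalRing gm.1).
  by move=> _ [f fm <-]; apply: cmin; exists (regular_fun f).
Qed.

Definition normalized_ratio : NL R F x := SigSub (mem_set value_ratio_normalized).

End Existence.

Lemma maximal_chain_nonincreasing (V : set K) r C i j : is_maximal_chain V r C ->
  (1 <= i)%N -> (i <= j <= r)%N -> C j `<=` C i.
Proof.
move=> [_ _ _ Cdec _] i1 /andP[/subnK <-]; elim: (j - i)%N => [_|n IH].
  by rewrite add0n; exact: subset_refl.
rewrite addSn => nr; apply: subset_trans (IH (ltnW nr)).
by apply: properW; apply: Cdec; rewrite nr (leq_trans i1)// leq_addl.
Qed.

Lemma canonical_image_exists (nu : RZ F x) (v : NL R F x) r C c :
  is_maximal_chain nu r C -> center_parameter (F := F) (x := x) nu c ->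
  (forall f, value v f = value_ratio R nu c (regular_fun f)) ->
  is_canonical_image nu v.
Proof.
move=> hchain hc vE; have [r1 Cr hC Cdec Call] := hchain.
have hV := ring_ofP nu; have cV := ring_of_centered nu.
have cN := parameter_not_unit hV cV hc; have [cm c0 cmin] := hc.
have Cmono := maximal_chain_nonincreasing hchain.
have VC i : (1 <= i <= r)%N -> ring_of nu `<=` C i.
  by move=> /andP[i1 ir]; rewrite -Cr; apply: Cmono => //; rewrite ir leqnn.
have centE i : (1 <= i <= r)%N -> centered F x (C i) <-> ~ C i c^-1.
  by move=> ir; apply: (centered_overring hV cV hc); [case: (hC i ir)|exact: VC].
have exj : exists i, `[< (1 <= i <= r)%N /\ ~ C i c^-1 >].
  by exists r; apply/asboolP; rewrite r1 leqnn Cr.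
case: (ex_minnP exj) => j /asboolP[jr Cjc] jmin.
have [j1 jr'] := andP jr.
have Cic i : (1 <= i < j)%N -> C i c^-1.
  move=> /andP[i1 ij]; apply: contrapT => ci.
  have : (j <= i)%N by apply: jmin; apply/asboolP; rewrite i1 (leq_trans (ltnW ij)).
  by rewrite leqNgt ij.
pose S := rank_one_ring R nu c; pose T := finite_ratio_ring R nu c.
have hS : valuation_ring S := rank_one_valuation_ring R hV c0 cN.
have hT : valuation_ring T := finite_ratio_valuation_ring R hV c0 cN.
have VS : ring_of nu `<=` S by exact: sub_rank_one_ring.
have ST : S `<=` T := @rank_one_finite_ratio R K nu c.
have VT : ring_of nu `<=` T by exact: subset_trans ST.
have SNT : S <> setT.
  by move=> SE; have := rank_one_center (R := R) hV c0 cN; rewrite -/S SE; apply.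
(* One inclusion is the maximality of [S]. For the other, [S] is some [C i] in which [c] is not a
   unit, and the minimality of [j] gives j <= i. *)
have CjS : C j = S.
  have [i ir CiS] := Call S hS VS SNT.
  apply/seteqP; split.
    by apply: rank_one_ring_max => //; [case: (hC j jr)|exact: VC].
  rewrite -CiS; apply: Cmono => //; case/andP: (ir) => i1 ->; rewrite andbT.
  apply: jmin; apply/asboolP; split=> //; rewrite CiS.
  exact: (rank_one_center hV c0 cN).
have TcV : T c^-1 := finite_ratio_center R hV c0 cN.
(* If [T] is not K, it is some [C i] containing [c^-1], so i < j. Then [C j.-1] is contained in [T],
   and equals it since it also inverts [c] and [T] is the smallest such ring. *)
have Tj : T <> setT -> (1 < j)%N /\ C j.-1 = T.
  move=> TNT; have [i ir CiT] := Call T hT VT TNT.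
  have [i1 ir'] := andP ir.
  have ij : (i < j)%N.
    rewrite ltnNge; apply/negP => ji; apply: Cjc.
    by apply: (Cmono j i j1) => //; rewrite ?ji ?ir'// CiT.
  have j2 : (1 < j)%N by exact: leq_ltn_trans ij.
  split=> //; apply/seteqP; split.
    rewrite -CiT; apply: Cmono => //; rewrite -ltnS prednK// ij.
    by rewrite (leq_trans _ jr')// leq_pred.
  have j'r : (1 <= j.-1 <= r)%N.
    by rewrite -ltnS prednK// j2 (leq_trans _ jr')// leq_pred.
  apply: (finite_ratio_ring_min hV c0 cN) => //; [by case: (hC _ j'r)|exact: VC|].
  by apply: Cic; rewrite -ltnS prednK// j2 leqnn.
exists r, C, j; split=> //.
- by apply/(centE j jr).
- move=> i /andP[i1 ij]; rewrite centE ?i1 ?(leq_trans (ltnW ij))//; apply.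
  by apply: Cic; rewrite i1.
split=> [j_1|j2].
  have TT : T = setT.
    by apply: contrapT => /Tj[]; rewrite j_1.
  (* The constant is 1 because the ratio is already normalized by [c]; the same holds in the
     composite case. *)
  rewrite -j_1 CjS; exists (value_ratio R nu c), 1; split.
  - exact: value_ratio_real_valuation.
  - exact: (value_ratio_center_min hV cV hc).
  - by move=> f _; rewrite vE invr1 mule1.
have TNT : T <> setT.
  move=> TT.
  have j'r : (1 <= j.-1 <= r)%N.
    by rewrite -ltnS prednK// j2 (leq_trans _ jr')// leq_pred.
  have [hC' CT] := hC _ j'r; apply: CT; apply/seteqP; split=> //.
  rewrite -TT; apply: (finite_ratio_ring_min hV c0 cN) => //; first exact: VC.
  by apply: Cic; rewrite -ltnS prednK// j2 leqnn.
have [_ ->] := Tj TNT; rewrite CjS.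
have [L [red hred]] := residue_field_exists hT.
exists L, red, (@residue_ratio R K nu c L red), 1; split=> //.
  exact: (residue_ratio_real_valuation hV c0 cN hred).
move=> f; rewrite vE; split.
  by move=> /(finite_ratio_nonunitsE R hV c0 cN).
move=> fN; rewrite mul1e (residue_ratioE hV c0 cN hred)//.
by apply/ST/VS; case: cV => + _; apply; exact: (valP f).
Qed.

(** Both cases reduce to [value_ratio_real]: the real valuation lives on the units of K when j = 1,
    and on those of [C j.-1], through the residue field, when j > 1. *)
Lemma canonical_image_unique (nu : RZ F x) (v : NL R F x) c :
  is_canonical_image nu v -> center_parameter (F := F) (x := x) nu c ->
  forall f, value v f = value_ratio R nu c (regular_fun f).
Proof.
move=> [r [C [j [hchain jr cCj _ vC]]]] hc f; have [r1 Cr hC Cdec _] := hchain.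
have Cmono := maximal_chain_nonincreasing hchain.
have hV := ring_ofP nu; have cV := ring_of_centered nu.
have cN := parameter_not_unit hV cV hc; have [cm c0 cmin] := hc.
have [j1 jr'] := andP jr.
have VC i : (1 <= i <= r)%N -> ring_of nu `<=` C i.
  by move=> /andP[i1 ir]; rewrite -Cr; apply: Cmono => //; rewrite ir leqnn.
have [hS _] := hC j jr; have VS := VC j jr.
have Sc : ~ C j c^-1 by apply/(centered_overring hV cV hc hS VS).
have OV : O `<=` nu by case: cV.
have hv : is_normalized_semivaluation (value v) := set_valP v.
have [-> | f0] := eqVneq f 0.
  by rewrite value_ratio0//; case: hv => _ [].
have fK0 : regular_fun f != 0 by apply: contra_neq f0 => fK0; exact/val_inj.
have sNK : is_subring [set: K] by [].
have unitT (g : K) : g != 0 -> is_unit setT g by [].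
case: vC; move: jr; rewrite leq_eqVlt => /andP[/predU1P[j_1|j2] _].
  move=> /(_ (esym j_1))[w [d [hw [[g gm gd] dmin] vE]]] _; rewrite vE//.
  rewrite j_1 in hw.
  have [wM wS] := real_valuation_fine hw; have [_ wfin wM' _ wS'] := hw.
  (* The minimum [d] is attained at some [g], and [g / c] lies in [C j], so the value of [c] is no
     larger. *)
  have wc : w c = d%:E.
    apply/eqP; rewrite eq_le dmin; last by exists c.
    rewrite andbT -gd -(divfK c0 g) wM' leeDr//.
    have : C j (g / c) by exact/VS/cmin.
    by rewrite -wS'.
  have d0 : 0 < d.
    have cV0 : c^-1 != 0 by rewrite invr_eq0.
    have w11 := wM 1 1 (oner_neq0 _) (oner_neq0 _); rewrite mulr1 in w11.
    have wcV := wM c c^-1 c0 cV0; rewrite divff// wc/= in wcV.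
    have /negP : ~ (0 <= fine (w c^-1)) by rewrite -wS// -j_1.
    by rewrite -ltNge; move: w11 wcV; lra.
  rewrite (value_ratio_real hV (phi := fine \o w) hS VS sNK)//=.
  - by rewrite wc/= EFinM fineK ?wfin.
  - by move=> f1 g1 [f10 _ _] [g10 _ _]; exact: wM.
  - by move=> f1 [f10 _ _]; exact: wS.
  - by rewrite wc.
move=> _ /(_ j2) [L [red [w [d [hred hw d0 vE]]]]].
have [_ redD redM _ redE] := hred.
set T := C j.-1 in hred redD redM redE vE.
have j'r : (1 <= j.-1 <= r)%N.
  by rewrite -ltnS prednK// j2 (leq_trans _ jr')// leq_pred.
have [hT _] : valuation_ring T /\ T <> setT := hC _ j'r.
have VT : ring_of nu `<=` T := VC _ j'r.
have ST : C j `<=` T.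
  apply: Cmono; first by case/andP: j'r.
  by rewrite leq_pred.
have sT := valuation_subring hT.
have [wM wS] := real_valuation_fine hw; have [_ wfin wM' _ wS'] := hw.
have [_ [_ _ _ _ [[g gm vg] vmin]]] := hv.
have gT : ~ nonunits T (regular_fun g).
  by move=> gN; have [/(_ gN)] := vE g; rewrite vg.
have gc : regular_fun g = regular_fun g / c * c by rewrite divfK.
(* An element [g] of value 1 is a multiple of [c] over the valuation ring; if [c] were in the
   kernel, so would be [g], whose value is finite. *)
have cT : ~ nonunits T c.
  move=> cT; apply: gT; rewrite gc; apply: (valuation_nonunitsM hT) cT.
  exact/VT/cmin.
have Uc : is_unit T c.
  have [_ ?] := not_nonunits (VT _ (OV _ cm.1)) cT.
  by split=> //; exact/VT/OV/cm.1.
have redU h : is_unit T h -> red h != 0.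
  move=> [h0 Th Th']; apply/eqP => /(redE _ Th)/(valuation_nonunitsE hT)[/eqP|//].
  by rewrite (negbTE h0).
pose cO : local_ring F x := LocalRing cm.1.
have vc : value v cO = 1%E.
  apply/eqP; rewrite eq_le vmin ?andbT; last by exists cO.
  rewrite -vg (vE g).2// (vE cO).2// lee_pmul2l// ?lte_fin//=.
  rewrite gc redM//; [|exact/VT/cmin|by case: Uc].
  rewrite wM' leeDr//.
  have : (red @` C j) (red (regular_fun g / c)).
    by exists (regular_fun g / c) => //; exact/VS/cmin.
  by rewrite -wS'.
(* Normalization pins the constant: [d] is the inverse of the value of the class of [c]. *)
have wc : d * fine (w (red c)) = 1.
  apply: EFin_inj; rewrite EFinM fineK ?wfin ?redU//.
  by rewrite -(vE cO).2//.
have phic : 0 < fine (w (red c)).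
  by rewrite -(pmulr_rgt0 _ d0) wc.
(* On the kernel, [f] is divisible by every power of [c]: [c] is a unit of [T], and nonunits of [T]
   lie in the valuation ring. *)
have [fN|fN] := pselect (nonunits T (regular_fun f)).
  rewrite (vE f).1// value_ratio_eqy// => n.
  apply: (nonunits_sub (V := ring_of nu)); apply: (overring_nonunits hV hT VT).
  rewrite mulrC; apply: (valuation_nonunitsM hT) fN.
  by rewrite -exprVn; apply: (subringX sT); case: Uc.
have Tf : T (regular_fun f) by exact/VT/OV/(valP f).
have Uf : is_unit T (regular_fun f) by have [_ ?] := not_nonunits Tf fN; split.
rewrite (vE f).2// (value_ratio_real hV (phi := fine \o w \o red) hS VS sT)//=.
- have dE : d = (fine (w (red c)))^-1.
    by apply: (mulIf (lt0r_neq0 phic)); rewrite wc mulVf// lt0r_neq0.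
  by rewrite mulrC EFinM fineK ?wfin ?redU// dE.
- move=> f1 g1 Uf1 Ug1; have [_ Tf1 _] := Uf1; have [_ Tg1 _] := Ug1.
  by rewrite redM// wM ?redU.
- move=> f1 Uf1; have [_ Tf1 _] := Uf1; rewrite -wS ?redU//.
  split; first by move=> Sf1; exists f1.
  (* [C j] is the full preimage of its image: two lifts differ by a nonunit of [T], which already
     lies in [C j]. *)
  move=> [s Ss sf1]; have Ts := ST _ Ss.
  have Tfs : T (f1 - s) by exact: (subringB sT).
  have fs : nonunits T (f1 - s).
    apply/(redE _ Tfs); apply: (@addIr _ (red s)).
    by rewrite -redD// subrK add0r.
  rewrite -(subrK s f1); apply: (subringD (valuation_subring hS)) => //.
  apply: nonunits_sub; exact: (overring_nonunits hS hT ST).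
Qed.

End CanonicalImage.

(** * Surjectivity *)

Section Lifting.
Context {R : realType} {k : fieldType} {X : space_over k} {K : fieldType}.
Context {F : function_field X K} {x : X}.
Local Notation O := (local_ring_set F x).
Local Notation A := (local_ring F x).

Context {v : A -> \bar R} (hv : is_normalized_semivaluation v).

Let v_ge0 f : (0 <= v f)%E. Proof. by case: hv. Qed.
Let v0 : v 0 = +oo%E. Proof. by case: hv => _ []. Qed.
Let vM f g : v (f * g) = (v f + v g)%E. Proof. by case: hv => _ []. Qed.
Let vD f g : (mine (v f) (v g) <= v (f + g)%R)%E. Proof. by case: hv => _ []. Qed.

Lemma semivaluation_constant (a : k) f : a != 0 ->
  regular_fun f = constant_function F a -> v f = 0%E.
Proof. by case: hv => _ [] _ + _ _ _; apply. Qed.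

Lemma semivaluation1 : v 1 = 0%E.
Proof.
apply: (semivaluation_constant (oner_neq0 k)).
exact/esym/(rmorph1 (constant_morphism (F := F))).
Qed.

Lemma semivaluationN f : v (- f) = v f.
Proof.
have vN1 : v (-1) = 0%E.
  apply: (@semivaluation_constant (- 1)); first by rewrite oppr_eq0 oner_neq0.
  exact/esym/(rmorphN1 (constant_morphism (F := F))).
by rewrite -mulN1r vM vN1 add0e.
Qed.

Lemma semivaluationX f n : v (f ^+ n) = ((n%:R)%:E * v f)%E.
Proof.
elim: n => [|n IH]; first by rewrite mul0e semivaluation1.
by rewrite exprS vM IH -natr1 EFinD ge0_muleDl// mul1e addeC.
Qed.

Lemma semivaluation_nonunit f : nonunits O (regular_fun f) -> (1 <= v f)%E.
Proof. by case: hv => _ [_ _ _ _ [_ +]]; move=> + fm; apply; exists f. Qed.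

Lemma semivaluation_neq0 g : v g != +oo%E -> regular_fun g != 0.
Proof.
by apply: contra_neq => g0; rewrite -v0; congr v; exact/val_inj.
Qed.

(* The preimage, in the localization of the local ring at the kernel of [v], of
   the valuation ring of the residue field on which [v] is a valuation. *)
Let B : set K := [set h | exists f g : A,
  [/\ v g != +oo%E, (v g <= v f)%E & h * regular_fun g = regular_fun f]].

Let vfin g : v g != +oo%E -> v g \is a fin_num.
Proof. by move=> gy; rewrite ge0_fin_numE// ltey. Qed.

Let vMfin f g : v f != +oo%E -> v g != +oo%E -> v (f * g) != +oo%E.
Proof. by move=> fy gy; rewrite vM -ltey lte_add_pinfty// ltey. Qed.

Let subB : is_subring B.
Proof.
split=> [|h1 h2 [f1 [g1 [g1y fg1 hE1]]] [f2 [g2 [g2y fg2 hE2]]]|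
    h1 h2 [f1 [g1 [g1y fg1 hE1]]] [f2 [g2 [g2y fg2 hE2]]]].
- exists 1, 1; rewrite semivaluation1; split=> //=; exact: mulr1.
- exists (f1 * g2 - f2 * g1), (g1 * g2); split; first exact: vMfin.
    apply: le_trans (vD _ _); rewrite semivaluationN !vM le_min leeD2r//=.
    by rewrite addeC leeD2r.
  by rewrite [regular_fun (g1 * g2)]/= [RHS]/= -hE1 -hE2; ring.
- exists (f1 * f2), (g1 * g2); split; first exact: vMfin.
    by rewrite !vM leeD.
  by rewrite [regular_fun (g1 * g2)]/= [RHS]/= -hE1 -hE2; ring.
Qed.

(** If h = f / g with v(g) < v(f) and h^-1 = f' / g' were in [B], then g g' = f f' would have two
    different values. *)
Let nonunitsB h : nonunits B h <-> exists f g : A,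
  [/\ v g != +oo%E, (v g < v f)%E & h * regular_fun g = regular_fun f].
Proof.
split.
  move=> /nonunitsE[[f [g [gy gf hE]]] hN]; exists f, g; split=> //.
  rewrite lt_neqAle gf andbT; apply/eqP => gfE.
  have fy : v f != +oo%E by rewrite -gfE.
  have f0 := semivaluation_neq0 fy; have g0 := semivaluation_neq0 gy.
  case: hN => [h0|]; first by move: f0; rewrite -hE h0 mul0r eqxx.
  apply; exists g, f; split; rewrite ?gfE//.
  have h0 : h != 0 by apply: contra_neq f0 => h0; rewrite -hE h0 mul0r.
  by rewrite -hE mulKf.
move=> [f [g [gy gf hE]]]; apply/nonunitsE; split.
  by exists f, g; split=> //; exact: ltW.
have [->|h0] := eqVneq h 0; first by left.
right=> -[f' [g' [gy' gf' hE']]].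
have ffgg : g * g' = f * f'.
  by apply/val_inj; rewrite /= -hE -hE'; field.
have := vM g g'; rewrite ffgg vM => /esym.
apply/eqP; rewrite lt_eqF//; apply: lte_leD => //; exact: vfin.
Qed.

Let idealB : is_ideal B (nonunits B).
Proof.
split; last by move=> f [].
- exact/nonunits0/(subring0 subB).
- move=> h1 h2 /nonunitsB[f1 [g1 [g1y fg1 hE1]]] /nonunitsB[f2 [g2 [g2y fg2 hE2]]].
  apply/nonunitsB; exists (f1 * g2 + f2 * g1), (g1 * g2); split; first exact: vMfin.
    apply: lt_le_trans (vD _ _); rewrite !vM lt_min lteD2rE ?vfin// fg1/=.
    by rewrite addeC lteD2rE ?vfin.
  by rewrite [regular_fun (g1 * g2)]/= [RHS]/= -hE1 -hE2; ring.
- move=> h1 h2 [f1 [g1 [g1y fg1 hE1]]] /nonunitsB[f2 [g2 [g2y fg2 hE2]]].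
  apply/nonunitsB; exists (f1 * f2), (g1 * g2); split; first exact: vMfin.
    by rewrite !vM addeC [ltRHS]addeC lte_leD ?vfin.
  by rewrite [regular_fun (g1 * g2)]/= [RHS]/= -hE1 -hE2; ring.
Qed.

Lemma semivaluation_lift : exists V c, [/\ valuation_ring V, centered F x V,
  center_parameter (F := F) (x := x) V c
  & forall f, v f = value_ratio R V c (regular_fun f)].
Proof.
have [V [hV BV VB]] := dominating_valuation_ring subB idealB.
have NV h : nonunits B h -> nonunits V h by rewrite -VB => -[].
have OB : O `<=` B.
  move=> f Of; exists (LocalRing Of), 1; rewrite semivaluation1 v_ge0; split=> //.
  exact: mulr1.
have OV := subset_trans OB BV.
have cV : centered F x V.
  split=> //; apply/seteqP; split=> f.
    move=> [/nonunitsE[Vf fN] Of]; apply/nonunitsE; split=> //.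
    by case: fN => [|fN]; [left|right=> /OV].
  move=> fm; have [Of _] := fm; split=> //; apply: NV; apply/nonunitsB.
  exists (LocalRing Of), 1; rewrite semivaluation1; split=> //.
    by apply: lt_le_trans (semivaluation_nonunit _); rewrite ?lte01.
  exact: mulr1.
have [_ [_ _ _ _ [[cO cm vc] _]]] := hv.
pose c : K := regular_fun cO.
have cy : v cO != +oo%E by rewrite vc.
have c0 : c != 0 := semivaluation_neq0 cy.
have hc : center_parameter (F := F) (x := x) V c.
  split=> // g gm; apply: BV; exists (LocalRing gm.1), cO; split=> //.
    by rewrite vc; exact: semivaluation_nonunit.
  by rewrite divfK.
have cN := parameter_not_unit hV cV hc.
have sV := valuation_subring hV.
have vcX n : v (cO ^+ n) = n%:R%:E by rewrite semivaluationX vc mule1.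
have val_X (g : A) n : regular_fun (g ^+ n) = regular_fun g ^+ n.
  by elim: n => [//|n IH]; rewrite !exprS -IH.
(* Both half implications are checked by the sign of the numerator; a negative one is harmless
   because [v] is nonnegative and [c] and [f] lie in [V]. *)
exists V, c; split=> // f; apply/esym/value_ratio_unique => -[] n b.
- move=> h; rewrite leNgt; apply/negP => fab.
  have fy : v f != +oo%E by rewrite -ltey (lt_trans fab)// ltry.
  have f0 := semivaluation_neq0 fy.
  (* If v(f) < n / (b+1), then c^n / f^(b+1) is a nonunit of [B], hence of [V] by domination; its
     inverse therefore cannot lie in [V]. *)
  have : nonunits B (c ^+ n / regular_fun f ^+ b.+1).
    apply/nonunitsB; exists (cO ^+ n), (f ^+ b.+1); rewrite vcX semivaluationX !val_X.
    rewrite divfK ?expf_neq0//; move: fab; rewrite -(fineK (vfin fy)) -EFinM !lte_fin.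
    by rewrite ltr_pdivlMr ?ltr0n// mulrC.
  move=> /NV/(valuation_nonunitsE hV)[/eqP|]; last by rewrite invf_div exprnN.
  by rewrite mulf_eq0 invr_eq0 !expf_eq0/= (negbTE c0) (negbTE f0) andbF.
- move=> _; apply: le_trans (v_ge0 f).
  by rewrite lee_fin NegzE intrN mulNr oppr_le0 divr_ge0// ?ler0z ler0n.
- move=> fab; apply: BV; exists (f ^+ b.+1), (cO ^+ n).
  rewrite vcX semivaluationX !val_X -exprnN divfK ?expf_neq0//; split=> //.
  have [->|fy] := eqVneq (v f) +oo%E; first by rewrite gt0_muley ?lte_fin ?ltr0n// leey.
  move: fab; rewrite -(fineK (vfin fy)) -EFinM lee_fin lte_fin.
  by rewrite ltr_pdivrMr ?ltr0n// mulrC => /ltW.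
- move=> _; rewrite NegzE opprK; apply: (subringM sV); apply: (subringX sV); apply: OV.
    exact: (valP f).
  by case: cm.
Qed.

End Lifting.

(** * Continuity *)

(** Nonstrict bounds near [t] suffice, since a fraction fits strictly between two distinct values;
    such bounds are what memberships in a valuation ring deliver. *)
Lemma cvg_ereal_fractions (R : realType) (T : topologicalType) (g : T -> \bar R) (t : T) :
  (forall (a : int) b, ((a%:~R / b.+1%:R)%:E < g t)%E ->
     \forall s \near t, ((a%:~R / b.+1%:R)%:E <= g s)%E) ->
  (forall (a : int) b, (g t < (a%:~R / b.+1%:R)%:E)%E ->
     \forall s \near t, (g s <= (a%:~R / b.+1%:R)%:E)%E) ->
  g @ t --> g t.
Proof.
move=> lower upper.
have lower' y : (y < g t)%E -> \forall s \near t, (y < g s)%E.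
  move=> /fraction_between_ereal[a [b /andP[ya /lower]]]; apply: filterS => s.
  exact: lt_le_trans.
have upper' y : (g t < y)%E -> \forall s \near t, (g s < y)%E.
  move=> /fraction_between_ereal[a [b /andP[/upper + ya]]]; apply: filterS => s.
  by move=> h; exact: le_lt_trans ya.
move=> U; rewrite /nbhs/= /ereal_nbhs/=; case gt : (g t) => [r||].
- move=> [e /= e0 eU].
  have h1 : \forall s \near t, ((r - e)%:E < g s)%E.
    by apply: lower'; rewrite gt lte_fin; lra.
  have h2 : \forall s \near t, (g s < (r + e)%:E)%E.
    by apply: upper'; rewrite gt lte_fin; lra.
  near=> s; have : ((r - e)%:E < g s < (r + e)%:E)%E.
    by apply/andP; split; near: s.
  rewrite /=; case: (g s) => [q||]; rewrite ?ltNge ?leey ?leNye ?andbF//.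
  by rewrite -!ltNge !lte_fin => h; apply: eU; rewrite /= ltr_distlC; lra.
- move=> [M [_ MU]]; have : \forall s \near t, (M%:E < g s)%E.
    by apply: lower'; rewrite gt ltry.
  by apply: filterS => s; exact: MU.
- move=> [M [_ MU]]; have : \forall s \near t, (g s < M%:E)%E.
    by apply: upper'; rewrite gt ltNyr.
  by apply: filterS => s; exact: MU.
Unshelve. all: by end_near. Qed.

Section CanonicalMapProperties.
Context {R : realType} {k : fieldType} {X : space_over k} {K : fieldType}.
Context {F : function_field X K} {x : X}.
Local Notation O := (local_ring_set F x).
Local Notation parameter := (@center_parameter k X K F x).

Lemma RZ_basis_nbhs (A : set K) (nu : RZ F x) : finite_set A ->
  RZ_basis A nu -> nbhs nu (RZ_basis A : set (RZ F x)).
Proof.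
move=> finA nuA; apply: open_nbhs_nbhs; split=> //.
by exists [set A]; [move=> _ ->|rewrite bigcup_set1].
Qed.

Context {s : seq K} (sm : forall g, g \in s -> nonunits O g).
Hypothesis s_generates : forall J, is_ideal O J -> (forall g, g \in s -> J g) ->
  nonunits O `<=` J.
Hypothesis maximal_neq0 : exists2 f, nonunits O f & f != 0.
Hypothesis finite_rank : forall nu : RZ F x, exists r C, is_maximal_chain nu r C.

(** The [g] in the local ring with [g / c] in [V] form an ideal, so it is enough to test generators
    of the maximal ideal. Being a parameter thus follows from finitely many memberships. *)
Lemma center_parameterP (V : set K) c : valuation_ring V -> O `<=` V ->
  c \in s -> c != 0 -> (forall g, g \in s -> V (g / c)) -> parameter V c.
Proof.
move=> hV OV cs c0 sc; have sV := valuation_subring hV.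
have sO := local_ring_subring (F := F) (x := x).
split=> //; first exact: sm.
suff : nonunits O `<=` [set g | O g /\ V (g / c)] by move=> h g /h[].
apply: s_generates; last first.
  by move=> g gs; split; [case: (sm gs)|exact: sc].
split.
- by split; rewrite ?mul0r; exact: subring0.
- move=> f g [Of Vf] [Og Vg]; split; first exact: (subringD sO).
  by rewrite mulrDl; exact: (subringD sV).
- move=> a f Oa [Of Vf]; split; first exact: (subringM sO).
  by rewrite -mulrA; apply: (subringM sV) => //; exact: OV.
- by move=> f [].
Qed.

(** A nonzero entry of least value is found by induction on the list; one exists since the maximal
    ideal is not zero. *)
Lemma parameter_exists (nu : RZ F x) : exists c,
  [/\ c \in s, c != 0 & forall g, g \in s -> ring_of nu (g / c)].
Proof.
have hV := ring_ofP nu; have sV := valuation_subring hV.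
have sO := local_ring_subring (F := F) (x := x).
have : exists2 g, g \in s & g != 0.
  apply: contrapT => none; have [f fm /eqP] := maximal_neq0; apply.
  suff : nonunits O `<=` [set 0] by apply.
  apply: s_generates => [|g gs]; last first.
    by have [//|g0] := eqVneq g 0; case: none; exists g.
  split=> //.
  - by move=> _ _ -> ->; exact: addr0.
  - by move=> a _ _ ->; exact: mulr0.
  - by move=> _ ->; exact: subring0.
elim: (s) => [[]//|h t IH] [g]; rewrite in_cons.
have [[c [ct c0 tc]] _|none] := pselect (exists c, [/\ c \in t, c != 0 &
    forall g, g \in t -> ring_of nu (g / c)]).
  have [->|h0] := eqVneq h 0.
    exists c; split=> //; first by rewrite in_cons ct orbT.
    move=> g'; rewrite in_cons => /predU1P[->|/tc//].
    by rewrite mul0r; exact: subring0.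
  case: (valuation_total hV (h / c)) => hc.
    exists c; split=> //; first by rewrite in_cons ct orbT.
    by move=> g'; rewrite in_cons => /predU1P[->|/tc//].
  exists h; split=> //; first by rewrite mem_head.
  move=> g'; rewrite in_cons => /predU1P[->|/tc gc].
    by rewrite divff//; exact: (subring1 sV).
  have -> : g' / h = (g' / c) * (c / h) by rewrite mulrA divfK.
  by apply: (subringM sV) => //; rewrite -invf_div.
have t0 g' : g' \in t -> g' = 0.
  by move=> g't; have [//|g'0] := eqVneq g' 0; case: none; apply: IH; exists g'.
move=> /predU1P[->|/t0 ->]; last by rewrite eqxx.
move=> h0; exists h; split=> //; first by rewrite mem_head.
move=> g'; rewrite in_cons => /predU1P[->|/t0 ->].
  by rewrite divff//; exact: (subring1 sV).
by rewrite mul0r; exact: subring0.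
Qed.

Lemma canonical_map_exists (nu : RZ F x) : exists v : NL R F x,
  forall c, parameter nu c -> forall f, value v f = value_ratio R nu c (regular_fun f).
Proof.
have hV := ring_ofP nu; have cV := ring_of_centered nu.
have [c [cs c0 sc]] := parameter_exists nu.
have hc : parameter nu c by apply: center_parameterP => //; case: cV.
have [r [C hC]] := finite_rank nu.
pose v := normalized_ratio (R := R) hV cV hc.
have vE f : value v f = value_ratio R nu c (regular_fun f) by [].
exists v => c' hc'; apply: canonical_image_unique hc'.
exact: canonical_image_exists hC hc vE.
Qed.

Definition canonical_map (nu : RZ F x) : NL R F x := sval (cid (canonical_map_exists nu)).

Lemma canonical_mapE (nu : RZ F x) c : parameter nu c ->
  forall f, value (canonical_map nu) f = value_ratio R nu c (regular_fun f).
Proof. by move=> hc f; rewrite /canonical_map; case: cid => v /= hv; exact: hv. Qed.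

Lemma value_inj (v w : NL R F x) : value v =1 value w -> v = w.
Proof. by move=> vw; apply/val_inj/funext. Qed.

Lemma canonical_mapP (nu : RZ F x) (v : NL R F x) :
  is_canonical_image nu v <-> canonical_map nu = v.
Proof.
have [c [cs c0 sc]] := parameter_exists nu.
have hc : parameter nu c.
  by apply: center_parameterP => //; [exact: ring_ofP|case: (ring_of_centered nu)].
split=> [h|<-].
  apply: value_inj => f; rewrite (canonical_mapE hc).
  by rewrite (canonical_image_unique h hc).
have [r [C hC]] := finite_rank nu.
exact: canonical_image_exists hC hc (canonical_mapE hc).
Qed.

Lemma canonical_map_surjective (v : NL R F x) : exists nu : RZ F x, canonical_map nu = v.
Proof.
have [V [c [hV cV hc vE]]] :=
  semivaluation_lift (set_valP v : is_normalized_semivaluation (value v)).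
have VC a : V (constant_function F a).
  by case: cV => + _; apply; exact: constant_local_ring.
exists (MkRZ hV VC cV); apply: value_inj => f.
by rewrite (@canonical_mapE (MkRZ hV VC cV) c hc) vE.
Qed.

Lemma canonical_map_continuous : continuous canonical_map.
Proof.
have pointwise (f : local_ring F x) : continuous (fun nu => value (canonical_map nu) f).
  move=> nu.
  have hV := ring_ofP nu.
  have [c [cs c0 sc]] := parameter_exists nu.
  have hc : parameter nu c.
    by apply: center_parameterP => //; case: (ring_of_centered nu).
  (* The memberships of the [g / c], for [g] in the finite list [s], define a basic open
     neighbourhood of [nu]. *)
  have near_c : \forall nu' \near nu, parameter (ring_of nu') c.
    have : nbhs nu (RZ_basis [set g / c | g in [set` s]] : set (RZ F x)).
      apply: RZ_basis_nbhs; first exact: finite_image.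
      by move=> _ [g gs <-]; exact: sc.
    apply: filterS => nu' nu's; apply: center_parameterP => //.
    - exact: ring_ofP.
    - by case: (ring_of_centered nu').
    - by move=> g gs; apply: nu's; exists g.
  have near_mem h : ring_of nu h -> \forall nu' \near nu, ring_of nu' h.
    move=> nuh; have : nbhs nu (RZ_basis [set h] : set (RZ F x)).
      by apply: RZ_basis_nbhs => // _ ->.
    by apply: filterS => nu' h'; exact: h'.
  have cN (nu' : RZ F x) : parameter (ring_of nu') c -> ~ ring_of nu' c^-1.
    by apply: parameter_not_unit; [exact: ring_ofP|exact: ring_of_centered].
  apply: cvg_ereal_fractions => a b; rewrite (canonical_mapE hc).
    move=> /(value_ratio_gt hV c0 (cN _ hc))/near_mem h.
    near=> nu'; rewrite (@canonical_mapE nu' c); last by near: nu'.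
    by apply: value_ratio_ge; near: nu'.
  move=> Wf.
  have f0 : regular_fun f != 0.
    by apply: contraTneq Wf => ->; rewrite value_ratio0// -leNgt leey.
  (* The upper bound excludes a membership; the inverse element then lies in the ring, which is an
     open condition. *)
  have h : ring_of nu (c ^ a * (regular_fun f)^-1 ^+ b.+1).
    case: (valuation_total hV (regular_fun f ^+ b.+1 * c ^ (- a))) => h.
      by move: Wf; rewrite ltNge value_ratio_ge.
    by move: h; rewrite invfM invr_expz opprK exprVn mulrC.
  have {}h := near_mem _ h.
  near=> nu'; have hc' : parameter (ring_of nu') c by near: nu'.
  rewrite (canonical_mapE hc'); apply: value_ratio_le => //.
  - exact: ring_ofP.
  - exact: cN.
  - by near: nu'.
(* The topology of [NL] is initial for the inclusion, and pointwise convergence is the supremum of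
   the initial topologies of the evaluations. *)
apply: continuous_comp_initial => nu.
apply/cvg_sup; first exact/fmap_filter/nbhs_filter.
move=> f.
have : continuous (set_val \o canonical_map : RZ F x ->
  initial_topology (fun v : {ptws local_ring F x -> \bar R} => v f)).
  by apply: continuous_comp_initial; exact: pointwise.
exact.
Unshelve. all: by end_near. Qed.

End CanonicalMapProperties.

(** * Local rings of varieties *)

Section IntegralScheme.
Context {X : ringed_space} (intX : is_integral X) {K : fieldType}.
Context (F : function_field X K).
Local Notation eta := (generic_point F).
Local Notation germF := (germ (generic_stalk F)).

Lemma generic_point_open (U : set X) (y : X) : open U -> U y -> open_nbhs eta U.
Proof.
move=> oU Uy; split=> //.
have : closure [set eta] y by rewrite generic_pointP.
by move=> /(_ U (open_nbhs_nbhs (conj oU Uy)))[_ [-> ]].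
Qed.

Lemma basic_open_open (U : set X) (s : sec U) : open (basic_open s).
Proof.
rewrite openE => y [V [VU [oV Vy [t st]]]]; rewrite /interior nbhsE.
by exists V => // z Vz; exists V, VU; split=> //; exists t.
Qed.

Lemma basic_openX (U : set X) (s : sec U) y n : basic_open s y -> basic_open (s ^+ n) y.
Proof.
move=> [V [VU [oV Vy [t st]]]]; exists V, VU; split=> //; exists (t ^+ n).
by rewrite rmorphXn -exprMn st expr1n.
Qed.

Lemma basic_open_germ (U : set X) (s : sec U) (y : X) (eU : open_nbhs eta U) :
  basic_open s y -> germF eU s != 0 /\ local_ring_set F y (germF eU s)^-1.
Proof.
move=> [V [VU [oV Vy [t st]]]]; have eV := generic_point_open oV Vy.
have h : germF eU s * germF eV t = 1.
  by rewrite -(germ_res _ eU eV VU) -rmorphM st rmorph1.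
have s0 : germF eU s != 0.
  by apply: contra_eq_neq h => ->; rewrite mul0r eq_sym oner_eq0.
split=> //; apply/asboolP; exists V, (conj oV Vy), eV, t.
by rewrite -(mulKf s0 (germF eV t)) h mulr1.
Qed.

Lemma germ_local_ring (U : set X) (s : sec U) (y : X) (eU : open_nbhs eta U) :
  U y -> local_ring_set F y (germF eU s).
Proof. by move=> Uy; apply/asboolP; exists U, (conj eU.1 Uy), eU, s. Qed.

Section Affine.
Context {U : set X} (aU : affine_open U).

Lemma affine_open_open : open U. Proof. by case: aU. Qed.

(** If D(s) were empty, locality for the empty cover would make its ring of sections zero, so a
    power of [s] would annihilate 1; in a domain this forces s = 0. *)
Lemma basic_open_neq0 (s : sec U) : U !=set0 -> s <> 0 -> basic_open s !=set0.
Proof.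
move=> U0 s0; apply: contrapT => none.
have [oU [_ _ _ loc]] := aU; have [_ _ kerP] := loc s.
have [n sn] : exists n, s ^+ n * 1 = 0.
  apply: kerP; apply: (@sheaf_locality X _ False (fun=> set0) (fun=> @sub0set _ _)) => //.
    exact: basic_open_open.
  by move=> y sy; case: none; exists y.
have [one0 dom] := intX.2 U oU U0.
rewrite mulr1 in sn; elim: n sn => [//|n IH]; rewrite exprS => /dom[//|]; exact: IH.
Qed.

Lemma basic_open_generic (s : sec U) : U !=set0 -> s <> 0 -> basic_open s eta.
Proof.
move=> U0 /(basic_open_neq0 U0)[y sy].
by case: (generic_point_open (@basic_open_open _ s) sy).
Qed.

Lemma germ_affine_inj (eU : open_nbhs eta U) (s : sec U) : germF eU s = 0 -> s = 0.
Proof.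
move=> s0; apply: contrapT => /basic_open_generic/=.
have U0 : U !=set0 by exists eta; exact: eU.2.
by move=> /(_ U0)/(basic_open_germ eU)[]; rewrite s0 eqxx.
Qed.

Lemma germ_basic_inj (b : sec U) (eD : open_nbhs eta (basic_open b))
  (r : sec (basic_open b)) : germF eD r = 0 -> r = 0.
Proof.
move=> r0; have [oU [_ _ _ /(_ b)[[u bu] locP _]]] := aU.
have eU : open_nbhs eta U by split=> //; apply: (@basic_open_sub _ _ b); exact: eD.2.
have [n [a ra]] := locP r.
have a0 : a = 0.
  apply: (germ_affine_inj (eU := eU)).
  by rewrite -(germ_res _ eU eD (@basic_open_sub _ _ b)) ra rmorphM r0 mul0r.
have : r * res (@basic_open_sub _ _ b) b ^+ n * u ^+ n = 0.
  by rewrite -ra a0 rmorph0 mul0r.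
by rewrite -mulrA -exprMn bu expr1n mulr1.
Qed.

(** Shrink [W] to a basic open neighbourhood of [y] in [U], whose sections are fractions with powers
    of [b] as denominators. *)
Lemma germ_fraction (eU : open_nbhs eta U) (y : X) (W : set X) (eW : open_nbhs eta W)
    (s : sec W) : U y -> W y ->
  exists a b : sec U, basic_open b y /\ germF eW s * germF eU b = germF eU a.
Proof.
move=> Uy Wy; have [oU [_ _ base loc]] := aU.
have [b [by_ bW]] := base W y eW.1 Wy Uy.
have eD := generic_point_open (@basic_open_open _ b) by_.
have [_ locP _] := loc b; have [n [a ra]] := locP (res bW s).
exists a, (b ^+ n); split; first exact: basic_openX.
rewrite -(germ_res _ eU eD (@basic_open_sub _ _ b) a) ra rmorphM/=.
by rewrite (germ_res _ eW) !rmorphXn (germ_res _ eU).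
Qed.

(** The inverse is the germ of a section near [x]. Its product with [a] is 1 at the generic point,
    hence on a basic open neighbourhood of [x], where generic germs determine sections. *)
Lemma local_ring_unit (eU : open_nbhs eta U) (x : X) (a : sec U) : U x ->
  germF eU a != 0 -> local_ring_set F x (germF eU a)^-1 -> basic_open a x.
Proof.
move=> Ux a0 /asboolP[W [[oW Wx] [eW [t ta]]]].
have [oU [_ _ base _]] := aU; have [b [bx bW]] := base W x oW Wx Ux.
have eD := generic_point_open (@basic_open_open _ b) bx.
exists (basic_open b), (@basic_open_sub _ _ b); split=> //; first exact: basic_open_open.
exists (res bW t); apply/eqP; rewrite -subr_eq0; apply/eqP.
apply: (germ_basic_inj (eD := eD)).
by rewrite rmorphB rmorphM rmorph1 (germ_res _ eU) (germ_res _ eW) ta divff// subrr.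
Qed.

Context {x : X} (Ux : U x) (eU : open_nbhs eta U).
Local Notation O := (local_ring_set F x).
Let subO : is_subring O.
Proof. by case: (local_ring_closed F x) => h1 hB hM; split. Qed.

Lemma basic_open_localP (a : sec U) :
  basic_open a x <-> germF eU a != 0 /\ O (germF eU a)^-1.
Proof.
split; first exact: basic_open_germ.
by move=> [a0 Oa]; exact: local_ring_unit Oa.
Qed.

Lemma local_ring_nonunitsP f : nonunits O f <-> exists a b : sec U,
  [/\ basic_open b x, ~ basic_open a x & f * germF eU b = germF eU a].
Proof.
split.
  move=> /nonunitsE[/asboolP[W [[oW Wx] [eW [s <-]]]] fN].
  have [a [b [bx ab]]] := germ_fraction eU eW s Ux Wx.
  exists a, b; split=> // /basic_open_localP[a0 Oa].
  have /basic_open_localP[b0 Ob] := bx.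
  have f0 : germF eW s != 0 by apply: contra_neq a0 => f0; rewrite -ab f0 mul0r.
  case: fN => [/eqP|]; first by rewrite (negbTE f0).
  apply; have -> : (germF eW s)^-1 = germF eU b * (germF eU a)^-1.
    by rewrite -ab invfM mulrCA divff// mulr1.
  by apply: (subringM subO) => //; exact: germ_local_ring.
move=> [a [b [/basic_open_localP[b0 Ob] ax ab]]].
have fE : f = germF eU a * (germF eU b)^-1 by rewrite -ab mulfK.
apply/nonunitsE; split.
  by rewrite fE; apply: (subringM subO) => //; exact: germ_local_ring.
have [->|f0] := eqVneq f 0; [by left|right=> Of].
apply: ax; apply/basic_open_localP; split; first by rewrite -ab mulf_neq0.
by rewrite -ab invfM; exact: (subringM subO).
Qed.

Lemma local_ring_maximal_ideal : is_ideal O (nonunits O).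
Proof.
have [oU [/(_ x Ux)[p0 pD pM p1 pP] _ _ _]] := aU.
have bM (a b : sec U) : basic_open a x -> basic_open b x -> basic_open (a * b) x.
  by move=> ax bx; apply: contrapT => /pP[].
split; last by move=> f [].
- by apply: nonunits0; exact: subring0.
- move=> f g /local_ring_nonunitsP[a [b [bx ax fE]]].
  move=> /local_ring_nonunitsP[a' [b' [bx' ax' gE]]].
  apply/local_ring_nonunitsP; exists (a * b' + a' * b), (b * b'); split.
  - exact: bM.
  - by apply: pD; rewrite mulrC; apply: pM.
  - by rewrite rmorphD !rmorphM -fE -gE; ring.
- move=> f g /asboolP[W [[oW Wx] [eW [s <-]]]].
  have [a [b [bx fE]]] := germ_fraction eU eW s Ux Wx.
  move=> /local_ring_nonunitsP[a' [b' [bx' ax' gE]]].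
  apply/local_ring_nonunitsP; exists (a * a'), (b * b'); split.
  - exact: bM.
  - by apply: pM.
  - by rewrite !rmorphM -fE -gE; ring.
Qed.

(** Otherwise [x] and the generic point both have zero vanishing ideal in [U], so they coincide; as
    [x] is closed, the space is then a single point, against the dimension. *)
Lemma local_ring_not_field : closed [set x] -> dim_ge X 1 ->
  exists2 f, nonunits O f & f != 0.
Proof.
move=> cx dimX; apply: contrapT => none.
have U0 : U !=set0 by exists x.
have [oU [prime uniq _ _]] := aU; have Ueta : U eta := eU.2.
have vx (a : sec U) : vanishing_ideal x a -> a = 0.
  move=> ax; apply: (germ_affine_inj (eU := eU)); apply/eqP; apply: contraT => a0.
  case: ax; apply/basic_open_localP; split=> //.
  have Oa : O (germF eU a) by exact: germ_local_ring.
  by have [] := @not_nonunits _ O _ Oa (fun aN => none (ex_intro2 _ _ _ aN a0)).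
have veta (a : sec U) : vanishing_ideal eta a -> a = 0.
  by move=> ay; apply: contrapT => a0; apply: ay; exact: basic_open_generic.
have [x0 _ _ _ _] := prime x Ux; have [eta0 _ _ _ _] := prime eta Ueta.
have vE : @vanishing_ideal X U eta = @vanishing_ideal X U x.
  by apply/seteqP; split=> a; [move=> /veta ->|move=> /vx ->].
have [z [_ zuniq]] := uniq _ (prime x Ux).
have etax : eta = x by rewrite -(zuniq eta (conj Ueta vE)) -(zuniq x (conj Ux erefl)).
have Xx : [set x] = setT.
  by rewrite -(generic_pointP F) etax; exact: (closure_id _).1.
have all_x (y : X) : y = x by have : [set x] y by rewrite Xx.
have [Z [irrZ Zlt]] := dimX; have [_ Z10] := Zlt 0%N isT.
have [_ [z0 Zz0] _] := irrZ 0%N isT.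
by apply: Z10 => y _; rewrite (all_x y) -(all_x z0).
Qed.

End Affine.
End IntegralScheme.

Section Variety.
Context {k : fieldType} (X : variety k) {K : fieldType} (F : function_field X K).
Local Notation eta := (generic_point F).
Local Notation germF := (germ (generic_stalk F)).
Let intX : is_integral X := variety_integral X.

Lemma germ_finitely_generated (U : set X) (eU : open_nbhs eta U) :
  finitely_generated U -> exists xs : seq K,
    (forall y, U y -> forall g, g \in xs -> local_ring_set F y g) /\
    (forall a : sec U, adjoin_seq (range (constant_morphism (F := F))) xs (germF eU a)).
Proof.
move=> [gs gen]; exists [seq germF eU g | g <- gs]; split.
  by move=> y Uy _ /mapP[g _ ->]; exact: germ_local_ring.
set A := adjoin_seq _ _.
have sR := range_subring (constant_morphism (F := F)).
have sA : is_subring A by exact: adjoin_seq_subring.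
suff AT : [set a : sec U | A (germF eU a)] = setT.
  by move=> a; have : setT a by []; rewrite -AT.
apply: gen => [c|s gs_s|s t As At|s t As At] /=.
- apply: sub_adjoin_seq => //; exists c => //.
  by rewrite /scalar_section (germ_res _ (open_nbhs_setT eta)).
- by apply: mem_adjoin_seq => //; exact: map_f.
- by rewrite rmorphD; exact: (subringD sA).
- by rewrite rmorphM; exact: (subringM sA).
Qed.

Lemma affine_finitely_generated_nbhs (x : X) : exists U : set X,
  [/\ affine_open U, finitely_generated U & U x].
Proof.
have [n [U [aU cover]]] := variety_finite_type X.
have : setT x by []; rewrite -cover => -[i _ Uix].
by exists (U i); split=> //; case: (aU i).
Qed.

(** The ring of an affine chart is a finitely generated algebra, hence noetherian. Generators of the
    contracted ideal also generate the maximal ideal of the local ring, whose elements are fractions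
    with denominator invertible at [x]. *)
Lemma local_ring_maximal_finitely_generated (x : X) : exists s : seq K,
  (forall g, g \in s -> nonunits (local_ring_set F x) g) /\
  forall J, is_ideal (local_ring_set F x) J -> (forall g, g \in s -> J g) ->
    nonunits (local_ring_set F x) `<=` J.
Proof.
set O := local_ring_set F x.
have [U [aU fgU Ux]] := affine_finitely_generated_nbhs x.
have eU := generic_point_open F (affine_open_open aU) Ux.
have [xs [xsO germA]] := germ_finitely_generated eU fgU.
set e := constant_morphism (F := F) in germA; set A := adjoin_seq (range e) xs in germA.
have sR : is_subring (range e) := range_subring e.
have sO : is_subring O := local_ring_subring.
have sA : is_subring A by exact: adjoin_seq_subring.
have AO : A `<=` O.
  apply: adjoin_seq_min => //; last exact: xsO.
  by move=> _ [c _ <-]; exact: constant_local_ring.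
have nA : noetherian A by apply: noetherian_adjoin_seq => //; exact: noetherian_field.
have hM : is_ideal O (nonunits O) := local_ring_maximal_ideal intX aU Ux eU.
have restrict J : is_ideal O J -> is_ideal A (J `&` A).
  move=> [J0 JD JM JO]; split; last by move=> f [].
  - by split=> //; exact: subring0.
  - by move=> f g [? ?] [? ?]; split; [exact: JD|exact: (subringD sA)].
  - by move=> a f Aa [? ?]; split; [apply: JM => //; exact: AO|exact: (subringM sA)].
have [s sI sgen] := nA _ (restrict _ hM).
exists s; split=> [g /sI[]//|J hJ Js f fm].
have [a [b [bx ax fE]]] := (local_ring_nonunitsP intX aU Ux eU f).1 fm.
have [b0 Ob] := basic_open_germ eU bx.
have -> : f = (germF eU b)^-1 * germF eU a by rewrite -fE mulrC mulfK.
have [_ _ JM _] := hJ; apply: JM => //.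
have IJ := sgen _ (restrict _ hJ) (fun g gs => conj (Js g gs) (sI g gs).2).
have [] // := IJ (germF eU a); split=> //.
rewrite -fE mulrC; case: hM => _ _ + _; apply => //; exact: germ_local_ring.
Qed.

Lemma function_field_fractions : exists xs : seq K, forall f : K, exists p q,
  [/\ adjoin_seq (range (constant_morphism (F := F))) xs p,
      adjoin_seq (range (constant_morphism (F := F))) xs q, q != 0 & f * q = p].
Proof.
have [U [aU fgU Ueta]] := affine_finitely_generated_nbhs eta.
have eU : open_nbhs eta U by split=> //; exact: affine_open_open.
have [xs [_ germA]] := germ_finitely_generated eU fgU.
exists xs => f; have [W [eW [s <-]]] := germ_surj (generic_stalk F) f.
have [a [b [beta fE]]] := germ_fraction aU eU eW s Ueta eW.2.
by exists (germF eU a), (germF eU b); split=> //; case: (basic_open_germ eU beta).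
Qed.

End Variety.

Unset Implicit Arguments.
Set Strict Implicit.

Theorem proposition2p12 (R : realType) (k : closedFieldType) (X : variety k)
    (dim_gt0 : dim_ge X 1) (x : X) (x_closed : closed [set x])
    (K : fieldType) (F : function_field X K) :
  exists pi : RZ F x -> NL R F x,
    [/\ (forall (nu : RZ F x) (v : NL R F x),
           is_canonical_image nu v <-> pi nu = v),
        (forall v : NL R F x, exists nu : RZ F x, pi nu = v)
      & continuous pi].
Proof.
have [s [sm sgen]] := local_ring_maximal_finitely_generated F x.
have [xs fractions] := function_field_fractions F.
have maximal_neq0 : exists2 f, nonunits (local_ring_set F x) f & f != 0.
  have [U [aU _ Ux]] := affine_finitely_generated_nbhs x.
  have eU := generic_point_open F (affine_open_open aU) Ux.
  exact: (local_ring_not_field (variety_integral X) aU Ux eU).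
have finite_rank (nu : RZ F x) : exists r C, is_maximal_chain nu r C.
  apply: (maximal_chain_exists (ring_ofP nu) fractions).
    exact: ring_of_constant.
  (* The trivial valuation is not centered in [x]: a nonzero element of the maximal ideal would be a
     nonunit of K. *)
  move=> nuT; have [f fm f0] := maximal_neq0.
  have /(valuation_nonunitsE (ring_ofP nu))[/eqP|] :=
    centered_sub_nonunits (ring_of_centered nu) fm; first by rewrite (negbTE f0).
  by rewrite nuT; apply.
exists (canonical_map sm sgen maximal_neq0 finite_rank); split.
- exact: canonical_mapP.
- exact: canonical_map_surjective.
- exact: canonical_map_continuous.
Qed.
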